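(* Let $f\colon\mathbb R\to\mathbb R$ be a locally absolutely continuous function. Then the graph welding $\varphi$ associated with $f$ is locally absolutely continuous.
   Context: A function on $\mathbb R$ is locally absolutely continuous if its restriction to every compact interval is absolutely continuous. Graph welding: let $\mathbb H$ and $\mathbb H^*$ be the upper and lower half-planes. For a continuous $f\colon\mathbb R\to\mathbb R$ let $F(x)=x+if(x)$ and let $\Gamma=F(\mathbb R)$ be the graph of $f$, so that $\Gamma\cup\{\infty\}$ is a Jordan curve in the Riemann sphere. Fix one of the two sides: either $\Omega$ is the domain above $\Gamma$ and $U=\mathbb H$, or $\Omega$ is the domain below $\Gamma$ and $U=\mathbb H^*$. Let $G\colon U\to\Omega$ be a conformal (biholomorphic) mapping with $G(\infty)=\infty$, meaning $G(z)\to\infty$ as $z\to\infty$. By Carathéodory's theorem $G$ extends to a homeomorphism of the closures, and its boundary values give a homeomorphism $G|_{\mathbb R}\colon\mathbb R\to\Gamma$. The graph welding associated with $f$ is the increasing homeomorphism $\varphi=G^{-1}\circ F\colon\mathbb R\to\mathbb R$. The statement is asserted for either choice of side and any such $G$. *)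

(* Defs.v *)
From HB Require Import structures.
From mathcomp Require Import all_boot all_order all_algebra.
From mathcomp Require Import complex.
From mathcomp Require Import all_classical all_reals all_analysis.

Set Implicit Arguments.
Unset Strict Implicit.
Unset Printing Implicit Defensive.

Import Order.TTheory GRing.Theory Num.Theory.
Import numFieldNormedType.Exports.

Local Open Scope classical_set_scope.
Local Open Scope ring_scope.
Local Open Scope complex_scope.

(* The Euclidean topology on [R[i]], as a one-dimensional normed module over
   itself: [derivable G z 1] is then complex differentiability of [G] at [z]. *)
HB.instance Definition _ (R : rcfType) := NormedModule.copy R[i] R[i]^o.

(* Empty intervals (x i = y i) are allowed; they contribute 0 to both sums. *)
Definition abs_continuous_on (R : realType) (a b : R) (f : R -> R) : Prop :=
  forall e : R, 0 < e -> exists2 d : R, 0 < d &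
    forall (n : nat) (x y : 'I_n -> R),
      (forall i, a <= x i /\ x i <= y i /\ y i <= b) ->
      trivIset setT (fun i => [set` `]x i, y i[]) ->
      \sum_(i < n) (y i - x i) < d ->
      \sum_(i < n) `|f (y i) - f (x i)| < e.

Definition locally_abs_continuous (R : realType) (f : R -> R) : Prop :=
  forall a b : R, a <= b -> abs_continuous_on a b f.

Definition holomorphic_on (R : realType) (U : set R[i]) (G : R[i] -> R[i]) :
    Prop :=
  forall z, U z -> derivable G z 1.

Definition biholomorphic (R : realType) (U V : set R[i]) (G : R[i] -> R[i]) :
    Prop :=
  [/\ set_bij U V G, holomorphic_on U G &
      exists2 H : R[i] -> R[i], holomorphic_on V H & {in U, cancel G H}].

Definition homeomorphism_on (R : realType) (A B : set R[i])
    (G : R[i] -> R[i]) : Prop :=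
  [/\ set_bij A B G, {within A, continuous G} &
      exists2 H : R[i] -> R[i], {within B, continuous H} & {in A, cancel G H}].

(* G(z) -> oo as z -> oo within U. *)
Definition fixes_infinity (R : realType) (U : set R[i]) (G : R[i] -> R[i]) :
    Prop :=
  forall M : R, exists N : R, forall z, U z ->
    N%:C < `|z| -> M%:C < `|G z|.

Inductive side := Above | Below.

Definition half_plane (R : realType) (s : side) : set R[i] :=
  match s with
  | Above => [set z | 0 < complex.Im z]
  | Below => [set z | complex.Im z < 0]
  end.

Arguments half_plane : clear implicits.

Definition graph_domain (R : realType) (s : side) (f : R -> R) : set R[i] :=
  match s with
  | Above => [set z | f (complex.Re z) < complex.Im z]
  | Below => [set z | complex.Im z < f (complex.Re z)]
  end.

Definition graph_map (R : realType) (f : R -> R) (x : R) : R[i] := x +i* f x.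

(* [Gbar] is the extension of [G] to the closures given by Caratheodory's
   theorem, uniquely determined by [G] on [closure (half_plane s)].  As [Gbar]
   is injective there, the last equation says phi = Gbar^-1 \o graph_map f. *)
Definition graph_welding (R : realType) (s : side) (f : R -> R)
    (G : R[i] -> R[i]) (phi : R -> R) : Prop :=
  exists Gbar : R[i] -> R[i],
    [/\ homeomorphism_on (closure (half_plane R s)) (closure (graph_domain s f))
          Gbar,
        {in half_plane R s, Gbar =1 G} &
        forall x : R, Gbar (phi x)%:C = graph_map f x].

(* Main.v *)
Require Import Defs.
From HB Require Import structures.
From mathcomp Require Import all_boot all_order all_algebra.
From mathcomp Require Import complex.
From mathcomp Require Import all_classical all_reals all_analysis.
From mathcomp Require Import ring lra.
Set Implicit Arguments.
Unset Strict Implicit.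
Unset Printing Implicit Defensive.
Import Order.TTheory GRing.Theory Num.Theory.
Import numFieldNormedType.Exports.
Local Open Scope ring_scope.

(** Let [g] be the boundary extension of the conformal map, reflected in the
    real line when the domain lies below the graph, so that [g] is continuous
    on the closed upper half-plane, holomorphic inside, and [g (phi x)] is the
    point of the graph over [x].  Say that [phi] is increasing (if it decreases,
    replace [x] by [- x]); only distances between points of the graph are used.

    The graph is locally rectifiable: if [V] is a variation function of [f],
    then the increments of [g] along the real line are dominated by those of
    the increasing continuous function [La := (id + V) \o phi^-1].  Since [f]
    is absolutely continuous, so is [V], so a family of disjoint intervals of
    small total length is mapped by [phi] to a family [J] over which [La] varies
    little.  What has to be shown is that [J] then has small total length, and
    this is a quantitative form of the theorem of F. and M. Riesz on harmonic
    measure, in the manner of Lavrentiev.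

    For small [h > 0] consider the difference quotient
    [D z = (g (z + h) - g z) / h].  At a fixed point [i m] it is bounded away
    from 0, because [g] has a holomorphic inverse.  Let [p] be holomorphic with
    real part proportional to the harmonic measure of [J].  In the rectangle
    with corners [- N], [N], [N + i N], [- N + i N] look at

      [Y z = D z * (z - N) * (z + N) * exp (L * (p z - correction))],

    where the correction makes the real part of the exponent nonpositive on the
    three sides off the real line.  There, [D z] is of order [1 / Im z] at
    worst, and the two linear factors compensate for this at the corners, so
    [Y] is bounded.  On the real side the integral of [|D|] is at most a
    variation of [La], so [Y] is integrable with a bound made of the total
    variation of [La] and of [exp (C L)] times its variation over [J].  The
    maximum principle bounds [Y (i m)] by the same quantities, while the
    exponential is at least [exp (c * L * |J|)] there.  Hence, if the variation
    over [J] is below [exp (- C L)], the length of [J] is [O(1 / L)]; and [L] is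
    arbitrary ([lavrentiev_estimate], [small_variation_small_length]).

    All Poisson integrals are replaced by finite sums of simple poles placed
    at the distance [h] below a grid of step [h], so that the only analytic tool
    is the maximum principle for the real part of a function that is complex
    differentiable at every point ([Re_maximum_principle]).  It is derived from
    Goursat's lemma: the real part [a] has locally a potential [p] with
    [p_x = a], the difference quotients of [p] in [x] are genuinely harmonic and
    converge to [a], so the second derivative test shows that [a] cannot have a
    strict local maximum ([no_strict_maximum]). *)

(** * Antiderivatives and mean values *)

Section RealLemmas.
Variable R : realType.
Implicit Types (a b c A C p : R -> R -> R) (f F : R -> R) (x y u v r s l e d : R).

Lemma is_derive_cont f x d : is_derive x 1 f d -> {for x, continuous f}.
Proof.
by move=> h; apply/differentiable_continuous/derivable1_diffP; case: h.
Qed.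

Lemma mvt_bound f (df : R -> R) u v e : u <= v ->
  (forall x, u <= x -> x <= v -> is_derive x 1 f (df x)) ->
  (forall x, u <= x -> x <= v -> `|df x| <= e) ->
  `|f v - f u| <= e * (v - u).
Proof.
move=> uv fd db.
have [||w /[!in_itv]/= /andP[uw wv] ->] := @MVT_segment R f df u v uv.
- by move=> x /[!in_itv]/= /andP[/ltW ux /ltW xv]; exact: fd.
- apply: derivable_within_continuous => x /[!in_itv]/= /andP[ux xv].
  by case: (fd x ux xv).
by rewrite normrM (ger0_norm (x := v - u)) ?subr_ge0// ler_wpM2r ?subr_ge0// db.
Qed.

Lemma antiderivative f l r :
  (forall x, l <= x -> x <= r -> {for x, continuous f}) ->
  exists F, forall x, l < x -> x < r -> is_derive x 1 F (f x).
Proof.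
move=> fc.
have [lr|rl] := ltP l r; last first.
  by exists f => x lx xr; move: (lt_trans lx xr); rewrite ltNge rl.
pose mu := @lebesgue_measure R.
exists (fun x => (\int[mu]_(t in [set` `[l, x]]) (f t))%R) => x lx xr.
have intf : mu.-integrable `[l, r] (EFin \o f).
  apply: continuous_compact_integrable; first exact: segment_compact.
  apply: continuous_in_subspaceT => z.
  by rewrite inE/= in_itv/= => /andP[lz zr]; exact: fc.
have [h1 h2] := @continuous_FTC1_closed R f l x r xr intf lx (fc _ (ltW lx) (ltW xr)).
by rewrite -h2 derive1E; exact/derivableP.
Qed.

End RealLemmas.

(** * Goursat's lemma for closed forms *)

Section Goursat.
Variable R : realType.
Local Open Scope classical_set_scope.
Implicit Types (a c A C p : R -> R -> R) (f F : R -> R).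
Implicit Types (x y u v w h r s t l e d al ga ka : R).

Definition has_gradient a x y al ga := forall e, 0 < e -> exists2 d, 0 < d &
  forall x' y', `|x' - x| < d -> `|y' - y| < d ->
  `|a x' y' - (a x y + al * (x' - x) + ga * (y' - y))|
     <= e * (`|x' - x| + `|y' - y|).

(** The integral of the form [a dx + c dy] around the rectangle with lower left
    corner [(x, y)] and sides [w], [h], expressed through antiderivatives [A] of
    [a] in [x] and [C] of [c] in [y], so that no integral has to be handled. *)
Definition circulation A C x y w h :=
  (A (x + w) y - A x y) + (C (x + w) (y + h) - C (x + w) y)
  - (A (x + w) (y + h) - A x (y + h)) - (C x (y + h) - C x y).

Lemma circulation_quarters A C x y w h :
  circulation A C x y (w + w) (h + h) =
  circulation A C x y w h + circulation A C (x + w) y w h +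
  (circulation A C x (y + h) w h + circulation A C (x + w) (y + h) w h).
Proof. by rewrite /circulation !addrA; ring. Qed.

(** Subtract from [F] a primitive of [m + k t]: the mean value inequality then
    only sees the deviation of [f] from this affine function. *)
Lemma primitive_bound f F x w e (m k : R) : 0 <= w ->
  (forall t, x <= t -> t <= x + w -> is_derive t 1 F (f t)) ->
  (forall t, x <= t -> t <= x + w -> `|f t - (m + k * t)| <= e) ->
  `|F (x + w) - F x - (m * w + k / 2 * (w * (x + x + w)))| <= e * w.
Proof.
move=> w0 dF bf.
have := @mvt_bound R (fun t => F t - (m * t + k / 2 * (t * t)))
  (fun t => f t - (m + k * t)) x (x + w) e.
rewrite lerDl => /(_ w0) H.
have -> : F (x + w) - F x - (m * w + k / 2 * (w * (x + x + w))) =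
  F (x + w) - (m * (x + w) + k / 2 * ((x + w) * (x + w))) -
  (F x - (m * x + k / 2 * (x * x))) by field.
have -> : e * w = e * (x + w - x) by ring.
apply: H => // t xt tw.
have dFt := dF _ xt tw.
apply: is_derive_eq.
by rewrite /GRing.scale/=; field.
Qed.

(** The circulation of the linearised form vanishes because [a] and [c] share
    the mixed coefficient [ga]; what is left is the error of linearisation. *)
Lemma circulation_bound a c A C x y w h s t al ga ka e : 0 <= w -> 0 <= h ->
  (forall x' y', x <= x' <= x + w -> y <= y' <= y + h ->
     [/\ is_derive x' 1 (A^~ y') (a x' y'), is_derive y' 1 (C x') (c x' y'),
      `|a x' y' - (a s t + al * (x' - s) + ga * (y' - t))| <= e &
      `|c x' y' - (c s t + ga * (x' - s) + ka * (y' - t))| <= e]) ->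
  `|circulation A C x y w h| <= 2 * e * (w + h).
Proof.
move=> w0 h0 H.
have xx : x <= x <= x + w by rewrite lexx lerDl.
have xw : x <= x + w <= x + w by rewrite lexx lerDl w0.
have yy : y <= y <= y + h by rewrite lexx lerDl.
have yh : y <= y + h <= y + h by rewrite lexx lerDl h0.
have HA y' : y <= y' <= y + h ->
  `|A (x + w) y' - A x y' - ((a s t - al * s + ga * (y' - t)) * w
      + al / 2 * (w * (x + x + w)))| <= e * w.
  move=> yy'; apply: (@primitive_bound (a^~ y') (A^~ y')) => // x' xx' xw'.
    by have [] := H x' y' ltac:(by rewrite xx' xw') yy'.
  have [_ _ h1 _] := H x' y' ltac:(by rewrite xx' xw') yy'.
  by rewrite (_ : _ + al * x' = a s t + al * (x' - s) + ga * (y' - t)) //; ring.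
have HC x' : x <= x' <= x + w ->
  `|C x' (y + h) - C x' y - ((c s t - ka * t + ga * (x' - s)) * h
      + ka / 2 * (h * (y + y + h)))| <= e * h.
  move=> xx'; apply: (@primitive_bound (c x') (C x')) => // y' yy' yh'.
    by have [] := H x' y' xx' ltac:(by rewrite yy' yh').
  have [_ _ _ h1] := H x' y' xx' ltac:(by rewrite yy' yh').
  by rewrite (_ : _ + ka * y' = c s t + ga * (x' - s) + ka * (y' - t)) //; ring.
have := HA _ yy; have := HA _ yh; have := HC _ xx; have := HC _ xw.
rewrite /circulation !ler_norml.
set X1 := A _ _ - A _ _; set X2 := A _ _ - A _ _.
set Y1 := C _ _ - C _ _; set Y2 := C _ _ - C _ _.
move=> /andP[h1 h2] /andP[h3 h4] /andP[h5 h6] /andP[h7 h8].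
by apply/andP; split; lra.
Qed.

(** The point singled out by repeatedly halving an interval of length [w]. *)
Lemma nested_sup (q : nat -> R) w : 0 <= w ->
  (forall n, q n <= q n.+1 <= q n + w / 2 ^+ n.+1) ->
  exists s, forall n, q n <= s <= q n + w / 2 ^+ n.
Proof.
move=> w0 hq.
have up m n : (m <= n)%N -> q m <= q n /\ q n + w / 2 ^+ n <= q m + w / 2 ^+ m.
  move=> mn; rewrite -(subnKC mn); elim: (n - m)%N => [|k [IH1 IH2]].
    by rewrite addn0.
  have /andP[h1 h2] := hq (m + k)%N; rewrite addnS; split; first exact: le_trans h1.
  apply: le_trans IH2; apply: le_trans (lerD h2 (lexx _)) _.
  rewrite -addrA lerD2l exprS.
  have p2 : (2 : R) ^+ (m + k) != 0 by rewrite expf_neq0.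
  by rewrite le_eqVlt; apply/orP; left; apply/eqP; field.
have bd n k : q k <= q n + w / 2 ^+ n.
  have wn j : 0 <= w / 2 ^+ j by rewrite divr_ge0// exprn_ge0.
  have [nk|/ltnW kn] := leqP n k.
    by have [_] := up _ _ nk; apply: le_trans; rewrite lerDl.
  by have [h1 _] := up _ _ kn; apply: le_trans h1 _; rewrite lerDl.
exists (sup (range q)) => n; apply/andP; split.
  apply: ub_le_sup; last by exists n.
  by exists (q n + w / 2 ^+ n) => _ [k _ <-].
apply: ge_sup; first by exists (q 0%N); exists 0%N.
by move=> _ [k _ <-].
Qed.

Lemma itv_dist x w s t :
  x <= s <= x + w -> x <= t <= x + w -> `|t - s| <= w.
Proof.
by move=> /andP[h1 h2] /andP[h3 h4]; rewrite ler_norml; apply/andP; split; lra.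
Qed.

(** One of the four quarters of a rectangle carries at least a quarter of its
    circulation.  Repeating this, the chosen quarters shrink to a point; since
    [a] and [c] are differentiable there, the circulation around small quarters
    is negligible compared with their area, which forces it to be 0 at the
    start. *)
Lemma goursat_rectangle a c A C x y w h : 0 <= w -> 0 <= h ->
  (forall x' y', x <= x' <= x + w -> y <= y' <= y + h ->
     [/\ is_derive x' 1 (A^~ y') (a x' y'), is_derive y' 1 (C x') (c x' y') &
      exists al ga ka, has_gradient a x' y' al ga /\ has_gradient c x' y' ga ka]) ->
  circulation A C x y w h = 0.
Proof.
move=> w0 h0 H.
pose L n (q : R * R) := `|circulation A C q.1 q.2 (w / 2 ^+ n) (h / 2 ^+ n)|.
have step n (q : R * R) : {q' : R * R |
    [/\ q.1 <= q'.1 <= q.1 + w / 2 ^+ n.+1, q.2 <= q'.2 <= q.2 + h / 2 ^+ n.+1 &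
     L n q <= 4 * L n.+1 q']}.
  apply: cid.
  set w1 := w / 2 ^+ n.+1; set h1 := h / 2 ^+ n.+1.
  have w1p : 0 <= w1 by rewrite divr_ge0// exprn_ge0.
  have h1p : 0 <= h1 by rewrite divr_ge0// exprn_ge0.
  have p2 : (2 : R) ^+ n != 0 by rewrite expf_neq0.
  have ew : w / 2 ^+ n = w1 + w1 by rewrite /w1 exprS; field.
  have eh : h / 2 ^+ n = h1 + h1 by rewrite /h1 exprS; field.
  apply: contrapT => N.
  have N' q' : q'.1 \in [:: q.1; q.1 + w1] -> q'.2 \in [:: q.2; q.2 + h1] ->
      4 * L n.+1 q' < L n q.
    rewrite !inE => /orP H1 /orP H2; rewrite ltNge; apply/negP => le.
    by apply: N; exists q'; split => //; [case: H1|case: H2] => /eqP ->;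
       rewrite ?lexx ?lerDl ?w1p ?h1p.
  have := N' (q.1, q.2); have := N' (q.1 + w1, q.2).
  have := N' (q.1, q.2 + h1); have := N' (q.1 + w1, q.2 + h1).
  rewrite !inE !eqxx !orbT /= => /(_ isT isT) N1 /(_ isT isT) N2.
  move=> /(_ isT isT) N3 /(_ isT isT) N4.
  have : L n q <= L n.+1 (q.1, q.2) + L n.+1 (q.1 + w1, q.2) +
     (L n.+1 (q.1, q.2 + h1) + L n.+1 (q.1 + w1, q.2 + h1)).
    rewrite {1}/L ew eh circulation_quarters.
    apply: le_trans (ler_normD _ _) _; apply: lerD; exact: ler_normD.
  by move: N1 N2 N3 N4; set l0 := L n q; lra.
pose q := fix q n := if n is k.+1 then sval (step k (q k)) else (x, y).
have qS n : [/\ (q n).1 <= (q n.+1).1 <= (q n).1 + w / 2 ^+ n.+1,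
     (q n).2 <= (q n.+1).2 <= (q n).2 + h / 2 ^+ n.+1 &
     L n (q n) <= 4 * L n.+1 (q n.+1)] by exact: (svalP (step n (q n))).
have [s Hs] : exists s, forall n, (q n).1 <= s <= (q n).1 + w / 2 ^+ n.
  by apply: nested_sup => // n; case: (qS n).
have [t Ht] : exists s, forall n, (q n).2 <= s <= (q n).2 + h / 2 ^+ n.
  by apply: nested_sup => // n; case: (qS n).
have xq n : x <= (q n).1 /\ (q n).1 + w / 2 ^+ n <= x + w.
  elim: n => [|n [IH1 IH2]]; first by rewrite /= expr0 divr1.
  have [/andP[h1 h2] _ _] := qS n; split; first exact: le_trans h1.
  apply: le_trans IH2.
  have p2 : (2 : R) ^+ n != 0 by rewrite expf_neq0.
  have -> : w / 2 ^+ n = w / 2 ^+ n.+1 + w / 2 ^+ n.+1 by rewrite exprS; field.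
  by rewrite addrA lerD2r.
have yq n : y <= (q n).2 /\ (q n).2 + h / 2 ^+ n <= y + h.
  elim: n => [|n [IH1 IH2]]; first by rewrite /= expr0 divr1.
  have [_ /andP[h1 h2] _] := qS n; split; first exact: le_trans h1.
  apply: le_trans IH2.
  have p2 : (2 : R) ^+ n != 0 by rewrite expf_neq0.
  have -> : h / 2 ^+ n = h / 2 ^+ n.+1 + h / 2 ^+ n.+1 by rewrite exprS; field.
  by rewrite addrA lerD2r.
have Lq n : L 0%N (x, y) <= 4 ^+ n * L n (q n).
  elim: n => [|n IH]; first by rewrite expr0 mul1r.
  apply: le_trans IH _; rewrite exprSr -mulrA ler_wpM2l ?exprn_ge0//.
  by case: (qS n).
have sx : x <= s <= x + w by have := Hs 0%N; rewrite /= expr0 divr1.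
have ty : y <= t <= y + h by have := Ht 0%N; rewrite /= expr0 divr1.
have [_ _ [al [ga [ka [da dc]]]]] := H s t sx ty.
(* at scale n the quarter lies where a and c are within e of their
   linearisations, and the factor 4^n is the ratio of the areas *)
have key e : 0 < e -> L 0%N (x, y) <= e * (2 * (w + h) * (w + h)).
  move=> e0; have [d1 d10 Ha] := da e e0; have [d2 d20 Hc] := dc e e0.
  have [n nlarge] : exists n, (w + h) / 2 ^+ n < Num.min d1 d2.
    have d0 : 0 < Num.min d1 d2 by rewrite lt_min d10.
    exists (Num.bound ((w + h) / Num.min d1 d2)).
    rewrite ltr_pdivrMr ?exprn_gt0// mulrC -ltr_pdivrMr//.
    apply: lt_le_trans (archi_boundP _) _; first by rewrite divr_ge0 ?addr_ge0 ?(ltW d0).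
    by rewrite -natrX ler_nat ltnW// ltn_expl.
  have w1p : 0 <= w / 2 ^+ n by rewrite divr_ge0// exprn_ge0.
  have h1p : 0 <= h / 2 ^+ n by rewrite divr_ge0// exprn_ge0.
  have wd : [/\ w / 2 ^+ n < d1, w / 2 ^+ n < d2, h / 2 ^+ n < d1 & h / 2 ^+ n < d2].
    move: nlarge; rewrite mulrDl lt_min => /andP[n1 n2].
    by split; [apply: le_lt_trans n1|apply: le_lt_trans n2|apply: le_lt_trans n1
      |apply: le_lt_trans n2]; rewrite ?lerDl ?lerDr.
  apply: le_trans (Lq n) _.
  apply: (@le_trans _ _
     (4 ^+ n * (2 * (e * ((w + h) / 2 ^+ n)) * ((w + h) / 2 ^+ n)))); last first.
    have -> : (4 : R) ^+ n = 2 ^+ n * 2 ^+ n by rewrite -exprMn; congr (_ ^+ _); ring.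
    have p2 : (2 : R) ^+ n != 0 by rewrite expf_neq0.
    by rewrite le_eqVlt; apply/orP; left; apply/eqP; field.
  rewrite ler_wpM2l ?exprn_ge0// (mulrDl w h (2 ^+ n)^-1).
  apply: (@circulation_bound a c _ _ _ _ _ _ s t al ga ka) => //.
  move=> x' y' hx hy; have [xq1 xq2] := xq n; have [yq1 yq2] := yq n.
  have bx := itv_dist (Hs n) hx; have by' := itv_dist (Ht n) hy.
  have [/andP[hx1 hx2] /andP[hy1 hy2]] := (hx, hy).
  have [||dA dC _] := H x' y'.
  - by rewrite (le_trans xq1 hx1) (le_trans hx2 xq2).
  - by rewrite (le_trans yq1 hy1) (le_trans hy2 yq2).
  have [w1d w2d h1d h2d] := wd.
  split => //.
    apply: le_trans (Ha _ _ (le_lt_trans bx w1d) (le_lt_trans by' h1d)) _.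
    by rewrite ler_pM2l// lerD.
  apply: le_trans (Hc _ _ (le_lt_trans bx w2d) (le_lt_trans by' h2d)) _.
  by rewrite ler_pM2l// lerD.
apply/eqP; rewrite -normr_eq0 eq_le normr_ge0 andbT.
have -> : `|circulation A C x y w h| = L 0%N (x, y).
  by rewrite /L /= expr0 !divr1.
apply/ler_addgt0Pr => e e0; rewrite add0r.
have W0 : 0 < 2 * (w + h) * (w + h) + 1 by rewrite ltr_wpDl// !mulr_ge0 ?addr_ge0.
apply: le_trans (key (e / (2 * (w + h) * (w + h) + 1)) _) _; first by rewrite divr_gt0.
rewrite mulrAC -mulrA ger_pMr// ler_pdivrMr// mul1r lerDl//.
Qed.

End Goursat.

(** * Potentials and the second derivative test *)

Section MaximumPrinciple.
Variable R : realType.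
Local Open Scope classical_set_scope.
Implicit Types (a b c A C p : R -> R -> R) (f F : R -> R).
Implicit Types (x y u v w h r s t l e d al be ga ka : R).

Lemma is_derive_epsP f x d : is_derive x 1 f d <->
  forall e, 0 < e -> exists2 r, 0 < r &
    forall x', `|x' - x| < r -> `|f x' - (f x + d * (x' - x))| <= e * `|x' - x|.
Proof.
split=> [df e e0|H].
  have dx : derivable f x 1 by case: df.
  have := derive_val (is_derive := df) => dv.
  have : h^-1 *: ((f \o shift x) (h *: 1%R) - f x) @[h --> 0^'] --> d.
    by rewrite -dv; exact: dx.
  move=> /cvgrPdist_le /(_ e e0).
  rewrite near_withinE => -/nbhs_ballP[r /= r0 Hr].
  exists r => // x' x'r.
  have [->|ne] := eqVneq x' x; first by rewrite subrr mulr0 addr0 subrr normr0 mulr0.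
  have h0 : x' - x != 0 by rewrite subr_eq0.
  have := Hr (x' - x); rewrite /ball/= sub0r normrN => /(_ x'r h0).
  rewrite /GRing.scale/= mulr1 subrK => le.
  have -> : f x' - (f x + d * (x' - x)) =
     - ((d - (x' - x)^-1 * (f x' - f x)) * (x' - x)) by field.
  by rewrite normrN normrM ler_wpM2r.
have cv : h^-1 *: ((f \o shift x) (h *: 1%R) - f x) @[h --> 0^'] --> d.
  apply/cvgrPdist_le => e e0; rewrite near_withinE.
  have [r r0 Hr] := H e e0; apply/nbhs_ballP; exists r => //= h.
  rewrite /ball/= sub0r normrN => hr h0.
  rewrite /GRing.scale/= mulr1.
  have := Hr (h + x); rewrite addrK => /(_ hr) le.
  have -> : d - h^-1 * (f (h + x) - f x) =
     - (h^-1 * (f (h + x) - (f x + d * h))) by field.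
  rewrite normrN normrM normfV mulrC ler_pdivrMr ?normr_gt0//.
apply: DeriveDef; first by apply/cvg_ex; exists d.
exact: cvg_lim cv.
Qed.

Lemma is_derive_translate f x h d :
  is_derive (x + h) 1 f d -> is_derive x 1 (fun t => f (t + h)) d.
Proof.
move=> /is_derive_epsP H; apply/is_derive_epsP => e e0.
have [r r0 Hr] := H e e0; exists r => // x' x'r.
have := Hr (x' + h); have -> : x' + h - (x + h) = x' - x by ring.
exact.
Qed.

Lemma has_gradient_derive a x y al ga : has_gradient a x y al ga ->
  is_derive x 1 (a^~ y) al /\ is_derive y 1 (a x) ga.
Proof.
move=> H; split; apply/is_derive_epsP => e e0; have [r r0 Hr] := H e e0;
  exists r => // z zr.
  by have := Hr z y zr; rewrite subrr normr0 mulr0 !addr0; exact.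
by have := Hr x z; rewrite subrr normr0 mulr0 addr0 add0r => /(_ r0 zr).
Qed.

Lemma has_gradient_continuous a x y al ga : has_gradient a x y al ga ->
  forall e, 0 < e -> exists2 d, 0 < d & forall x' y',
    `|x' - x| < d -> `|y' - y| < d -> `|a x' y' - a x y| < e.
Proof.
move=> H e e0; have [d d0 Hd] := H 1 ltr01.
pose M := 2 + `|al| + `|ga|.
have M0 : 0 < M by rewrite /M ltr_wpDr// ltr_wpDr.
have M3 : 0 < M + M + M by lra.
have [Ma Mg M2] : [/\ `|al| <= M, `|ga| <= M & 2 <= M].
  by rewrite /M; have := normr_ge0 al; have := normr_ge0 ga; split; lra.
clearbody M.
exists (Num.min d (e / (M + M + M))) => [|x' y'].
  by rewrite lt_min d0 divr_gt0.
rewrite !lt_min => /andP[xd xe] /andP[yd ye].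
have h := Hd x' y' xd yd; rewrite mul1r in h.
have -> : a x' y' - a x y = (a x' y' - (a x y + al * (x' - x) + ga * (y' - y)))
   + (al * (x' - x) + ga * (y' - y)) by ring.
apply: le_lt_trans (ler_normD _ _) _.
apply: le_lt_trans (lerD h (ler_normD _ _)) _; rewrite !normrM.
have h1 : `|al| * `|x' - x| <= M * `|x' - x| by rewrite ler_wpM2r.
have h2 : `|ga| * `|y' - y| <= M * `|y' - y| by rewrite ler_wpM2r.
have h3 : 2 * `|x' - x| <= M * `|x' - x| by rewrite ler_wpM2r.
have h4 : 2 * `|y' - y| <= M * `|y' - y| by rewrite ler_wpM2r.
rewrite ltr_pdivlMr // in xe; rewrite ltr_pdivlMr // in ye.
rewrite (mulrC _ (M + M + M)) !(mulrDl _ _ `|x' - x|) in xe.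
rewrite (mulrC _ (M + M + M)) !(mulrDl _ _ `|y' - y|) in ye.
have := normr_ge0 (x' - x); have := normr_ge0 (y' - y); lra.
Qed.

Lemma eps_continuous2 (F : R -> R -> R) x y :
  (forall e, 0 < e -> exists2 d, 0 < d & forall x' y',
    `|x' - x| < d -> `|y' - y| < d -> `|F x' y' - F x y| < e) ->
  {for (x, y), continuous (fun z : R * R => F z.1 z.2)}.
Proof.
move=> H; apply/cvgrPdist_lt => e e0; have [d d0 Hd] := H e e0.
exists (ball x d, ball y d) => [|-[x' y'] [/= h1 h2]].
  by split; exact: nbhsx_ballx.
by rewrite distrC; apply: Hd; rewrite distrC.
Qed.

(** Integrate the form along a path with one horizontal and one vertical leg.
    Ending with the vertical leg gives the derivative in [y]; by
    [goursat_rectangle] the other order gives the same value up to a constant,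
    which yields the derivative in [x]. *)
Lemma closed_form_potential a c x1 y1 r : 0 < r ->
  (forall x y, `|x - x1| <= 2 * r -> `|y - y1| <= 2 * r ->
     exists al ga ka, has_gradient a x y al ga /\ has_gradient c x y ga ka) ->
  exists p, forall x y, `|x - x1| < r -> `|y - y1| < r ->
    is_derive x 1 (p^~ y) (a x y) /\ is_derive y 1 (p x) (c x y).
Proof.
move=> r0 H.
have exA y : exists F, `|y - y1| < 2 * r ->
    forall x, `|x - x1| < 2 * r -> is_derive x 1 F (a x y).
  have [yr|] := ltP (`|y - y1|) (2 * r); last by exists id.
  have [x xl|F HF] := @antiderivative _ (a^~ y) (x1 - 2 * r) (x1 + 2 * r).
    move=> xr; have [|al [ga [ka [da _]]]] := H x y _ (ltW yr).
      by rewrite ler_norml; apply/andP; split; lra.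
    by have [/is_derive_cont] := has_gradient_derive da.
  exists F => _ x; rewrite ltr_norml => /andP[h1 h2]; apply: HF; lra.
have exC x : exists F, `|x - x1| < 2 * r ->
    forall y, `|y - y1| < 2 * r -> is_derive y 1 F (c x y).
  have [xr|] := ltP (`|x - x1|) (2 * r); last by exists id.
  have [y yl|F HF] := @antiderivative _ (c x) (y1 - 2 * r) (y1 + 2 * r).
    move=> yr; have [|al [ga [ka [_ dc]]]] := H x y (ltW xr).
      by rewrite ler_norml; apply/andP; split; lra.
    by have [_ /is_derive_cont] := has_gradient_derive dc.
  exists F => _ y; rewrite ltr_norml => /andP[h1 h2]; apply: HF; lra.
(* the base point is chosen so that all the rectangles based at it have
   nonnegative sides *)
have [A0 HA] := choice exA; have [C HC] := choice exC.
pose A x y := A0 y x; pose x0 := x1 - r; pose y0 := y1 - r.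
exists (fun x y => A x y0 + C x y - C x y0) => x y xr yr.
have r2 : r < 2 * r by lra.
split; last first.
  have D := HC x (lt_trans xr r2) y (lt_trans yr r2).
  by apply: is_derive_eq; ring.
have G x' : `|x' - x1| < r ->
    A x' y0 + C x' y - C x' y0 = A x' y + (A x0 y0 - A x0 y + C x0 y - C x0 y0).
  move=> x'r; move: (x'r) (yr); rewrite !ltr_norml => /andP[h1 h2] /andP[h3 h4].
  have := @goursat_rectangle _ a c A C x0 y0 (x' - x0) (y - y0).
  have -> : circulation A C x0 y0 (x' - x0) (y - y0) =
      A x' y0 - A x0 y0 + (C x' y - C x' y0) - (A x' y - A x0 y) -
      (C x0 y - C x0 y0).
    have ex : x0 + (x' - x0) = x' by ring.
    have ey : y0 + (y - y0) = y by ring.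
    by rewrite /circulation ex ey.
  move=> g0.
  suff : A x' y0 - A x0 y0 + (C x' y - C x' y0) - (A x' y - A x0 y) -
      (C x0 y - C x0 y0) = 0 by lra.
  rewrite -g0 /x0 /y0; [ring|lra|lra|].
  move=> u v /andP[u1 u2] /andP[v1 v2].
  have ur : `|u - x1| < 2 * r by rewrite ltr_norml; apply/andP; split; lra.
  have vr : `|v - y1| < 2 * r by rewrite ltr_norml; apply/andP; split; lra.
  by split; [exact: HA|exact: HC|exact: H (ltW ur) (ltW vr)].
have : is_derive x 1 (fun t => A t y + (A x0 y0 - A x0 y + C x0 y - C x0 y0)) (a x y).
  have D : is_derive x 1 (A^~ y) (a x y) := HA y (lt_trans yr r2) x (lt_trans xr r2).
  by apply: is_derive_eq; ring.
move=> /is_derive_epsP D; apply/is_derive_epsP => e e0.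
have [d d0 Hd] := D e e0.
exists (Num.min d (r - `|x - x1|)); first by rewrite lt_min d0 subr_gt0.
move=> x'; rewrite lt_min => /andP[x'd x'r].
rewrite !G//; first exact: Hd.
have -> : x' - x1 = (x' - x) + (x - x1) by ring.
by apply: le_lt_trans (ler_normD _ _) _; lra.
Qed.

(** With [ka > 0] the derivative [df], which vanishes at the maximum [x], would be
    positive just after it. *)
Lemma second_derivative_test f df x ka r : 0 < r ->
  (forall t, `|t - x| < r -> is_derive t 1 f (df t)) ->
  is_derive x 1 df ka ->
  (forall t, `|t - x| < r -> f t <= f x) -> ka <= 0.
Proof.
move=> r0 dF /is_derive_epsP d2 mx; rewrite leNgt; apply/negP => k0.
have df0 : df x = 0.
  have := dF x; rewrite subrr normr0 => /(_ r0) D.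
  have -> : df x = 'D_1 f x by rewrite (derive_val (is_derive := D)).
  apply: derive_val.
  apply: (@derive1_at_max _ f (x - r / 2) (x + r / 2)) => [|t|| t].
  - lra.
  - rewrite in_itv/= => /andP[h1 h2].
    have := dF t; rewrite ltr_norml => H; case: H => //.
    by apply/andP; split; lra.
  - by rewrite in_itv/=; apply/andP; split; lra.
  - rewrite in_itv/= => /andP[h1 h2]; apply: mx.
    by rewrite ltr_norml; apply/andP; split; lra.
have [d d0 Hd] := d2 (ka / 2) ltac:(lra).
pose h := Num.min d r / 2.
have h0 : 0 < h by rewrite divr_gt0// lt_min d0.
have hd : h < d.
  by rewrite /h ltr_pdivrMr// gt_min; apply/orP; left; lra.
have hr : h < r.
  by rewrite /h ltr_pdivrMr// gt_min; apply/orP; right; lra.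
have [|||t] := @MVT R f df x (x + h).
- lra.
- move=> t; rewrite in_itv/= => /andP[t1 t2]; apply: dF.
  by rewrite ltr_norml; apply/andP; split; lra.
- apply: derivable_within_continuous => t; rewrite in_itv/= => /andP[t1 t2].
  have := dF t; rewrite ltr_norml => H; case: H => //.
  by apply/andP; split; lra.
rewrite in_itv/= => /andP[t1 t2].
have tx : 0 < t - x by lra.
have := Hd t; rewrite (gtr0_norm tx) => /(_ ltac:(lra)).
rewrite df0 add0r ler_norml => /andP[le _] E.
have dt : 0 < df t.
  by apply: lt_le_trans (_ : ka / 2 * (t - x) <= _); [rewrite mulr_gt0; lra|lra].
have := mx (x + h); rewrite (addrC x h) addrK gtr0_norm// => /(_ hr).
rewrite addrC leNgt => /negP; apply.
by rewrite -subr_gt0 E mulr_gt0//; lra.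
Qed.

End MaximumPrinciple.

(** * Complex differentiability in real coordinates *)

Section ComplexDerivative.
Variable R : realType.
Local Open Scope classical_set_scope.
Local Open Scope complex_scope.
Implicit Types (z w : R[i]) (g : R[i] -> R[i]).
Local Notation normc := ComplexField.Normc.normc.

Lemma normc_norm z : `|z| = (normc z)%:C.
Proof. by case: z. Qed.

Lemma normc_ge0 z : 0 <= normc z.
Proof. by case: z => a b; exact: sqrtr_ge0. Qed.

Lemma normcE z : normc z = Num.sqrt (complex.Re z ^+ 2 + complex.Im z ^+ 2).
Proof. by case: z. Qed.

Lemma normc_D z w : normc (z + w) <= normc z + normc w.
Proof. by rewrite -lecR rmorphD/= -!normc_norm ler_normD. Qed.

Lemma normcN z : normc (- z) = normc z.
Proof. by apply: complexI; rewrite -!normc_norm normrN. Qed.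

Lemma normcB_sym z w : normc (z - w) = normc (w - z).
Proof. by rewrite -normcN opprB. Qed.

Lemma Re_le_normc z : `|complex.Re z| <= normc z.
Proof.
by rewrite normcE -sqrtr_sqr ler_wsqrtr// lerDl sqr_ge0.
Qed.

Lemma Im_le_normc z : `|complex.Im z| <= normc z.
Proof.
by rewrite normcE -sqrtr_sqr ler_wsqrtr// lerDr sqr_ge0.
Qed.

Lemma normc_le_ReIm z : normc z <= `|complex.Re z| + `|complex.Im z|.
Proof.
rewrite normcE -[leRHS]ger0_norm ?addr_ge0// -sqrtr_sqr ler_wsqrtr//.
by rewrite sqrrD !real_normK ?num_real// -addrA lerD2l lerDr mulrn_wge0// mulr_ge0.
Qed.

Lemma normc0 : normc (0 : R[i]) = 0.
Proof. by rewrite normcE /= expr0n/= addr0 sqrtr0. Qed.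

Lemma normc_eq0 z : (normc z == 0) = (z == 0).
Proof.
apply/eqP/eqP => [/ComplexField.Normc.eq0_normc//|->]; exact: normc0.
Qed.

Lemma normcM z w : normc (z * w) = normc z * normc w.
Proof. exact: ComplexField.Normc.normcM. Qed.

Lemma normcV z : normc z^-1 = (normc z)^-1.
Proof. exact: ComplexField.Normc.normcV. Qed.

Lemma normc_gt0 z : (0 < normc z) = (z != 0).
Proof. by rewrite lt_neqAle normc_ge0 andbT eq_sym normc_eq0. Qed.

Lemma ReD z w : complex.Re (z + w) = complex.Re z + complex.Re w.
Proof. by case: z; case: w. Qed.
Lemma ImD z w : complex.Im (z + w) = complex.Im z + complex.Im w.
Proof. by case: z; case: w. Qed.
Lemma ReN z : complex.Re (- z) = - complex.Re z.
Proof. by case: z. Qed.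
Lemma ImN z : complex.Im (- z) = - complex.Im z.
Proof. by case: z. Qed.
Lemma ReM z w : complex.Re (z * w) =
  complex.Re z * complex.Re w - complex.Im z * complex.Im w.
Proof. by case: z; case: w. Qed.
Lemma ImM z w : complex.Im (z * w) =
  complex.Re z * complex.Im w + complex.Im z * complex.Re w.
Proof. by case: z; case: w. Qed.

Lemma derivable_epsP g z : derivable g z 1 <->
  exists d, forall e : R, 0 < e -> exists2 r : R, 0 < r & forall w,
    normc (w - z) < r -> normc (g w - (g z + d * (w - z))) <= e * normc (w - z).
Proof.
split=> [/cvg_ex[/= d cv]|[d H]].
  exists d => e e0.
  move: cv => /cvgrPdist_le /(_ e%:C); rewrite ltcR => /(_ e0).
  rewrite near_withinE => -/nbhs_ballP[r /= r0 Hr].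
  move: r0 Hr; case: r => r ri; rewrite ltcE/= => /andP[/eqP -> r0] Hr.
  exists r => // w wr.
  have [->|ne] := eqVneq w z.
    by rewrite subrr mulr0 addr0 subrr normc0 mulr0.
  have h0 : w - z != 0 by rewrite subr_eq0.
  have := Hr (w - z); rewrite /ball/= sub0r normrN normc_norm complexr0 ltcR.
  move=> /(_ wr h0).
  rewrite /GRing.scale/= mulr1 subrK.
  rewrite normc_norm lecR => le.
  have -> : g w - (g z + d * (w - z)) =
     - ((d - (w - z)^-1 * (g w - g z)) * (w - z)) by field.
  by rewrite normcN normcM ler_wpM2r ?normc_ge0.
apply/cvg_ex; exists d.
apply/cvgrPdist_le => -[e ei]; rewrite ltcE/= => /andP[/eqP -> e0].
rewrite near_withinE.
have [r r0 Hr] := H e e0; apply/nbhs_ballP; exists r%:C => /=; first by rewrite ltcR.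
move=> h; rewrite /ball/= sub0r normrN normc_norm ltcR => hr h0.
rewrite /GRing.scale/= mulr1 normc_norm complexr0 lecR.
have := Hr (h + z); rewrite addrK => /(_ hr) le.
have -> : d - h^-1 * (g (h + z) - g z) =
   - (h^-1 * (g (h + z) - (g z + d * h))) by field.
rewrite normcN normcM normcV mulrC.
by rewrite ler_pdivrMr ?normc_gt0.
Qed.

Lemma derivable_has_gradient g x y : derivable g (x +i* y) 1 -> exists al be,
  has_gradient (fun x y => complex.Re (g (x +i* y))) x y al (- be) /\
  has_gradient (fun x y => complex.Im (g (x +i* y))) x y be al.
Proof.
move=> /derivable_epsP[d H]; exists (complex.Re d), (complex.Im d).
split=> e e0; have [r r0 Hr] := H e e0; exists (r / 2); rewrite ?divr_gt0//.
all: move=> x' y' hx hy.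
all: have le2 : normc ((x' +i* y') - (x +i* y)) <= `|x' - x| + `|y' - y|
  by exact: normc_le_ReIm.
all: have le1 := Hr (x' +i* y') ltac:(lra).
all: apply: le_trans (_ : _ <= e * normc ((x' +i* y') - (x +i* y))) _;
  last by rewrite ler_pM2l.
all: apply: le_trans le1.
  apply: le_trans (Re_le_normc _); rewrite le_eqVlt; apply/orP; left; apply/eqP.
  by congr (`| _ |); rewrite !(ReD, ReN, ReM)/=; ring.
apply: le_trans (Im_le_normc _); rewrite le_eqVlt; apply/orP; left; apply/eqP.
by congr (`| _ |); rewrite !(ImD, ImN, ImM)/= addrA; ring.
Qed.

End ComplexDerivative.

(** * Real parts have no strict maximum *)

Section NoStrictMaximum.
Variable R : realType.
Local Open Scope classical_set_scope.
Local Open Scope complex_scope.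
Implicit Types (a b p : R -> R -> R) (g : R[i] -> R[i]) (x y u v r h e d : R).

Lemma mvt_bound_sym (f df : R -> R) u v e :
  (forall x, `|x - u| <= `|v - u| -> is_derive x 1 f (df x)) ->
  (forall x, `|x - u| <= `|v - u| -> `|df x| <= e) ->
  `|f v - f u| <= e * `|v - u|.
Proof.
move=> fd db; have [uv|/ltW vu] := leP u v.
  rewrite (ger0_norm (x := v - u)) ?subr_ge0//.
  apply: (@mvt_bound _ f df) => // x ux xv; [apply: fd|apply: db];
    by rewrite !ger0_norm ?subr_ge0// lerD2r.
rewrite distrC (distrC v u) (ger0_norm (x := u - v)) ?subr_ge0//.
apply: (@mvt_bound _ f df) => // x ux xv; [apply: fd|apply: db];
  by rewrite !ler0_norm ?subr_le0// lerN2 lerD2r.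
Qed.

Lemma has_gradientN a x y al ga : has_gradient a x y al ga ->
  has_gradient (fun x y => - a x y) x y (- al) (- ga).
Proof.
move=> H e e0; have [d d0 Hd] := H e e0; exists d => // x' y' hx hy.
rewrite -normrN; apply: le_trans (Hd _ _ hx hy); rewrite le_eqVlt; apply/orP.
by left; apply/eqP; congr (`| _ |); ring.
Qed.

(** The partial derivatives are bounded near a point, so the potential is
    Lipschitz there. *)
Lemma gradient_continuous a b p x1 y1 r x y :
  (forall x y, `|x - x1| < r -> `|y - y1| < r ->
    is_derive x 1 (p^~ y) (a x y) /\ is_derive y 1 (p x) (b x y)) ->
  (exists al ga ka la, has_gradient a x y al ga /\ has_gradient b x y ka la) ->
  `|x - x1| < r -> `|y - y1| < r ->
  forall e, 0 < e -> exists2 d, 0 < d & forall x' y',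
    `|x' - x| < d -> `|y' - y| < d -> `|p x' y' - p x y| < e.
Proof.
move=> dp [al [ga [ka [la [da db]]]]] xr yr e e0.
have [d1 d10 H1] := has_gradient_continuous da ltr01.
have [d2 d20 H2] := has_gradient_continuous db ltr01.
pose M := 1 + `|a x y| + `|b x y|.
have M0 : 0 < M by rewrite /M ltr_wpDr// ltr_wpDr.
pose d := Num.min (Num.min d1 d2)
  (Num.min (Num.min (r - `|x - x1|) (r - `|y - y1|)) (e / (M + M))).
exists d; first by rewrite !lt_min d10 d20 !subr_gt0 xr yr divr_gt0// addr_gt0.
move=> x' y'; rewrite !lt_min => /and3P[/andP[xd1 xd2] /andP[xd3 _] xd5].
move=> /and3P[/andP[yd1 yd2] /andP[_ yd4] yd5].
have inx t : `|t - x| <= `|x' - x| -> `|t - x1| < r.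
  move=> tx; have -> : t - x1 = (t - x) + (x - x1) by ring.
  by apply: le_lt_trans (ler_normD _ _) _; lra.
have iny t : `|t - y| <= `|y' - y| -> `|t - y1| < r.
  move=> ty; have -> : t - y1 = (t - y) + (y - y1) by ring.
  by apply: le_lt_trans (ler_normD _ _) _; lra.
have b1 : `|p x' y' - p x y'| <= M * `|x' - x|.
  apply: (@mvt_bound_sym (p^~ y') (a^~ y')) => t tx.
    by have [] := dp t y' (inx _ tx) (iny _ (lexx _)).
  have := H1 t y' (le_lt_trans tx xd1) yd1.
  have := ler_normD (a t y' - a x y) (a x y); rewrite subrK /M.
  by have := normr_ge0 (b x y); lra.
have b2 : `|p x y' - p x y| <= M * `|y' - y|.
  apply: (@mvt_bound_sym (p x) (b x)) => t ty.
    by have [] := dp x t xr (iny _ ty).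
  have := H2 x t; rewrite subrr normr0 => /(_ d20 (le_lt_trans ty yd2)).
  have := ler_normD (b x t - b x y) (b x y); rewrite subrK /M.
  by have := normr_ge0 (a x y); lra.
have -> : p x' y' - p x y = (p x' y' - p x y') + (p x y' - p x y) by ring.
apply: le_lt_trans (ler_normD _ _) _; apply: le_lt_trans (lerD b1 b2) _.
have M2 : 0 < M + M by rewrite addr_gt0.
move: xd5 yd5; rewrite !ltr_pdivlMr// !(mulrC _ (M + M)) !mulrDl => h1 h2.
by lra.
Qed.

(** Here [a] and [b] are the real and imaginary parts of a holomorphic function.
    The second derivative test does not apply to [a], which is only known to be
    once differentiable.  It does apply to the difference quotient in [x] of a
    potential [p] of [a dx - b dy]: its second derivatives in [x] and [y] are
    difference quotients of [a_x] and of [- b_y], and they cancel by the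
    Cauchy-Riemann equations.  As this quotient is close to [a], it inherits an
    interior maximum even after half of the strictness has been spent on the
    term [e / 2 * |z - z1|^2], whose Laplacian is positive. *)
Lemma no_strict_maximum a b x1 y1 r e : 0 < r -> 0 < e ->
  (forall x y, `|x - x1| <= 2 * r -> `|y - y1| <= 2 * r ->
    exists al be, has_gradient a x y al (- be) /\ has_gradient b x y be al) ->
  ~ (forall x y, `|x - x1| < r -> `|y - y1| < r ->
       a x y <= a x1 y1 - e * ((x - x1) ^+ 2 + (y - y1) ^+ 2)).
Proof.
move=> r0 e0 H mx.
have [p dp] : exists p, forall x y, `|x - x1| < r -> `|y - y1| < r ->
    is_derive x 1 (p^~ y) (a x y) /\ is_derive y 1 (p x) (- b x y).
  apply: (@closed_form_potential _ a (fun x y => - b x y)) => // x y hx hy.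
  have [al [be [da db]]] := H x y hx hy.
  by exists al, (- be), (- al); split => //; exact: has_gradientN.
have z1 (z : R) : `|z - z| < r by rewrite subrr normr0.
have rr u : `|u| < r -> `|u| <= 2 * r by lra.
have [al1 [be1 [da1 _]]] := H x1 y1 (rr _ (z1 _)) (rr _ (z1 _)).
pose q := r / 2.
have q0 : 0 < q by rewrite divr_gt0.
have qr : q + q = r by rewrite /q; field.
have e8 : 0 < e * q ^+ 2 / 8 by rewrite divr_gt0// mulr_gt0// exprn_gt0.
have [d d0 Hd] := has_gradient_continuous da1 e8.
(* the step is small compared with the square, and with the distance within
   which a stays close to its value at the centre *)
pose h := Num.min d q / 8.
have h0 : 0 < h by rewrite divr_gt0// lt_min d0.
have hd : h < d.
  by rewrite /h ltr_pdivrMr// gt_min; apply/orP; left; lra.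
have hq : h <= q / 8.
  by rewrite /h ler_pM2r ?invr_gt0// ge_min lexx orbT.
have xh x : `|x - x1| <= q -> forall t, x <= t <= x + h -> `|t - x1| < r.
  rewrite ler_norml => /andP[h1 h2] t /andP[t1 t2].
  by rewrite ltr_norml; apply/andP; split; lra.
have qlt u : `|u| <= q -> `|u| < r by lra.
pose E x y := (p (x + h) y - p x y) / h
   + e / 2 * ((x - x1) ^+ 2 + (y - y1) ^+ 2).
have xxh x : x <= x <= x + h by rewrite lexx lerDl ltW.
have xhh x : x <= x + h <= x + h by rewrite lexx lerDl ltW.
have mean x y : `|x - x1| <= q -> `|y - y1| <= q ->
    exists2 t, x <= t <= x + h & (p (x + h) y - p x y) / h = a t y.
  move=> hx hy.
  have [|||t] := @MVT_segment R (p^~ y) (a^~ y) x (x + h).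
  - by rewrite lerDl ltW.
  - move=> t; rewrite in_itv/= => /andP[/ltW t1 /ltW t2].
    by have [] := dp t y (xh x hx t ltac:(by rewrite t1)) (qlt _ hy).
  - apply: derivable_within_continuous => t; rewrite in_itv/= => t12.
    by have [[]] := dp t y (xh x hx t t12) (qlt _ hy).
  rewrite in_itv/= => t12 ->; exists t => //.
  by rewrite (addrC x h) addrK mulfK// gt_eqF.
have Ecenter : a x1 y1 - e * q ^+ 2 / 8 < E x1 y1.
  have [||t /andP[t1 t2] Et] := mean x1 y1; rewrite ?subrr ?normr0 ?ltW//.
  rewrite /E Et !subrr expr0n/= addr0 mulr0 addr0.
  have := Hd t y1; rewrite subrr normr0 ger0_norm ?subr_ge0//.
  move=> /(_ ltac:(lra) d0); rewrite ltr_norml => /andP[]; lra.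
(* the quadratic term costs only half of the gap, so E is smaller on the
   boundary of the square than at its centre *)
have Ebd x y : `|x - x1| <= q -> `|y - y1| <= q ->
    q <= `|x - x1| \/ q <= `|y - y1| -> E x y <= a x1 y1 - e * q ^+ 2 / 4.
  move=> hx hy bd; have [t t12 Et] := mean x y hx hy.
  have := mx t y (xh x hx t t12) (qlt _ hy); rewrite /E Et => le.
  move: t12 => /andP[t1 t2].
  have s2 : q ^+ 2 <= (x - x1) ^+ 2 + (y - y1) ^+ 2.
    have sq u : q <= `|u| -> q ^+ 2 <= u ^+ 2.
      by move=> qu; rewrite -(real_normK (num_real u)) ler_sqr ?nnegrE// ltW.
    by case: bd => /sq; have := sqr_ge0 (x - x1); have := sqr_ge0 (y - y1);
      clear -q; lra.
  have s1 : (x - x1) ^+ 2 - q ^+ 2 / 4 <= (t - x1) ^+ 2.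
    have -> : t - x1 = (x - x1) + (t - x) by ring.
    rewrite [leRHS]sqrrD -addrA lerD2l.
    move: hx; rewrite ler_norml => /andP[u1 u2].
    have := sqr_ge0 (t - x).
    have : - (q * h) <= (x - x1) * (t - x).
      have m1 : - q * (t - x) <= (x - x1) * (t - x) by rewrite ler_wpM2r ?subr_ge0.
      have m2 : q * (t - x) <= q * h by rewrite ler_pM2l//; lra.
      lra.
    have : q * h <= q * (q / 8) by rewrite ler_pM2l.
    by lra.
  have m3 := ler_wpM2l (ltW e0) s1; have m4 := ler_wpM2l (ltW e0) s2.
  lra.
have cE x y : `|x - x1| <= q -> `|y - y1| <= q ->
    {for (x, y), continuous (fun z : R * R => E z.1 z.2)}.
  move=> hx hy.
  have cp u : `|u - x1| < r -> forall eps, 0 < eps -> exists2 dd, 0 < dd &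
      forall x' y', `|x' - u| < dd -> `|y' - y| < dd ->
        `|p x' y' - p u y| < eps.
    move=> ur; apply: (@gradient_continuous a (fun x y => - b x y) p x1 y1 r) => //.
      have [al [be [da db]]] := H u y (rr _ ur) (rr _ (qlt _ hy)).
      by exists al, (- be), (- be), (- al); split => //; exact: has_gradientN.
    exact: qlt.
  have c1 : {for (x, y), continuous (fun z : R * R => p z.1 z.2)}.
    exact: eps_continuous2 (cp _ (qlt _ hx)).
  have c2 : {for (x, y), continuous (fun z : R * R => p (z.1 + h) z.2)}.
    apply: (@eps_continuous2 _ (fun s t => p (s + h) t)) => eps eps0.
    have [dd dd0 Hdd] := cp _ (xh x hx _ (xhh x)) eps eps0.
    exists dd => // x' y' hx' hy'; apply: Hdd => //.
    by rewrite (_ : x' + h - (x + h) = x' - x) //; ring.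
  have cx : {for (x, y), continuous (fun z : R * R => z.1)} by exact: cvg_fst.
  have cy : {for (x, y), continuous (fun z : R * R => z.2)} by exact: cvg_snd.
  apply: cvgD.
    apply: cvgM; last exact: cvg_cst.
    exact: cvgB c2 c1.
  apply: cvgM; first exact: cvg_cst.
  apply: cvgD; rewrite expr2; apply: cvgM; apply: cvgB => //; exact: cvg_cst.
pose S : set (R * R) := `[x1 - q, x1 + q] `*` `[y1 - q, y1 + q].
have inS x y : S (x, y) <-> `|x - x1| <= q /\ `|y - y1| <= q.
  rewrite /S /= !in_itv/= !ler_norml; clear -q; split => -[/andP[h1 h2] /andP[h3 h4]];
  by split; apply/andP; split; lra.
have [|||[x2 y2]] := @compact_EVT_max _ R (fun z : R * R => E z.1 z.2) S.
- by exists (x1, y1); apply/inS; rewrite !subrr normr0 ltW.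
- apply: compact_setX; exact: segment_compact.
- apply: continuous_in_subspaceT => -[x y]; rewrite inE => /inS[hx hy].
  exact: cE.
rewrite inE => /inS[hx2 hy2] mE.
have mE' x y : `|x - x1| <= q -> `|y - y1| <= q -> E x y <= E x2 y2.
  by move=> hx hy; apply: (mE (x, y)); rewrite inE; apply/inS.
have [x2q y2q] : `|x2 - x1| < q /\ `|y2 - y1| < q.
  have c1 := mE' x1 y1; rewrite !subrr normr0 in c1.
  have {}c1 := c1 (ltW q0) (ltW q0).
  have eq0 : 0 < e * q ^+ 2 by rewrite mulr_gt0// exprn_gt0.
  by split; rewrite ltNge; apply/negP => bd;
     [have := Ebd x2 y2 hx2 hy2 (or_introl bd)
     |have := Ebd x2 y2 hx2 hy2 (or_intror bd)]; lra.
have [al [be [da db]]] := H x2 y2 (rr _ (qlt _ hx2)) (rr _ (qlt _ hy2)).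
have x2h : `|x2 + h - x1| < r := xh x2 hx2 _ (xhh x2).
have [al' [be' [da' db']]] := H (x2 + h) y2 (rr _ x2h) (rr _ (qlt _ hy2)).
have [ax _] := has_gradient_derive da; have [_ byy] := has_gradient_derive db.
have [ax' _] := has_gradient_derive da'; have [_ by'] := has_gradient_derive db'.
have Sx : (al' - al) / h + e <= 0.
  pose dE x := (a (x + h) y2 - a x y2) / h + e * (x - x1).
  apply: (@second_derivative_test _ (E^~ y2) dE x2 _ (q - `|x2 - x1|)).
  - by rewrite subr_gt0.
  - move=> t ht; have htq : `|t - x1| <= q.
      have -> : t - x1 = (t - x2) + (x2 - x1) by ring.
      by apply: le_trans (ler_normD _ _) _; lra.
    have [D1 _] := dp _ _ (xh t htq _ (xhh t)) (qlt _ hy2).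
    have {}D1 := is_derive_translate D1.
    have [D2 _] := dp _ _ (qlt _ htq) (qlt _ hy2).
    by rewrite /E /dE; apply: is_derive_eq; rewrite /GRing.scale/=; field; rewrite gt_eqF.
  - have D1 := is_derive_translate ax'.
    by rewrite /dE; apply: is_derive_eq; rewrite /GRing.scale/=; field; rewrite gt_eqF.
  - move=> t ht; apply: mE' => //.
    have -> : t - x1 = (t - x2) + (x2 - x1) by ring.
    by apply: le_trans (ler_normD _ _) _; lra.
have Sy : (al - al') / h + e <= 0.
  pose dE y := (b x2 y - b (x2 + h) y) / h + e * (y - y1).
  apply: (@second_derivative_test _ (E x2) dE y2 _ (q - `|y2 - y1|)).
  - by rewrite subr_gt0.
  - move=> t ht; have htq : `|t - y1| <= q.
      have -> : t - y1 = (t - y2) + (y2 - y1) by ring.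
      by apply: le_trans (ler_normD _ _) _; lra.
    have [_ D1] := dp _ _ x2h (qlt _ htq).
    have [_ D2] := dp _ _ (qlt _ hx2) (qlt _ htq).
    by rewrite /E /dE; apply: is_derive_eq; rewrite /GRing.scale/=; field; rewrite gt_eqF.
  - by rewrite /dE; apply: is_derive_eq; rewrite /GRing.scale/=; field; rewrite gt_eqF.
  - move=> t ht; apply: mE' => //.
    have -> : t - y1 = (t - y2) + (y2 - y1) by ring.
    by apply: le_trans (ler_normD _ _) _; lra.
have := lerD Sx Sy; rewrite addr0.
have -> : (al' - al) / h + e + ((al - al') / h + e) = 2 * e by field; rewrite gt_eqF.
by lra.
Qed.

End NoStrictMaximum.

(** * The maximum principle on rectangles *)

Section RectangleMaximum.
Variable R : realType.
Local Open Scope classical_set_scope.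
Local Open Scope complex_scope.
Implicit Types (a b p : R -> R -> R) (g Y V : R[i] -> R[i]) (x y u v r h e d : R).
Local Notation normc := ComplexField.Normc.normc.

Definition rectangle (l1 r1 l2 r2 : R) : set R[i] :=
  [set z | (l1 <= complex.Re z <= r1) /\ (l2 <= complex.Im z <= r2)].

Definition rectangle_boundary (l1 r1 l2 r2 : R) : set R[i] :=
  [set z | rectangle l1 r1 l2 r2 z /\
    [\/ complex.Re z = l1, complex.Re z = r1, complex.Im z = l2
      | complex.Im z = r2]].

Definition open_rectangle (l1 r1 l2 r2 : R) : set R[i] :=
  [set z | (l1 < complex.Re z < r1) /\ (l2 < complex.Im z < r2)].

Lemma within_continuous_epsP (A : set R[i]) g : {within A, continuous g} <->
  forall z, A z -> forall e, 0 < e -> exists2 d, 0 < d &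
    forall w, A w -> normc (w - z) < d -> normc (g w - g z) < e.
Proof.
rewrite subspace_continuousP; split=> [cg z Az e e0|H z Az].
  have /cvgrPdist_lt /(_ e%:C) := cg z Az; rewrite ltcR => /(_ e0).
  rewrite near_withinE => -/nbhs_ballP[r /= r0 Hr].
  move: r0 Hr; case: r => r ri; rewrite ltcE/= => /andP[/eqP -> r0] Hr.
  exists r => // w Aw wr; have := Hr w; rewrite /ball/= complexr0 !normc_norm !ltcR.
  by rewrite (normcB_sym z w) (normcB_sym (g z)); apply.
apply/cvgrPdist_lt => -[e ei]; rewrite ltcE/= => /andP[/eqP -> e0].
rewrite near_withinE complexr0.
have [r r0 Hr] := H z Az e e0; apply/nbhs_ballP; exists r%:C => /=; first by rewrite ltcR.
move=> w; rewrite /ball/= !normc_norm !ltcR (normcB_sym z) (normcB_sym (g z)) => wr Aw.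
exact: Hr.
Qed.

Lemma has_gradient_affine a x y al ga (k l : R) : has_gradient a x y al ga ->
  has_gradient (fun x y => a x y + (k * x + l * y)) x y (al + k) (ga + l).
Proof.
move=> H e e0; have [d d0 Hd] := H e e0; exists d => // x' y' hx hy.
apply: le_trans (Hd _ _ hx hy); rewrite le_eqVlt; apply/orP.
by left; apply/eqP; congr (`| _ |); ring.
Qed.

(** Transfers continuity to [R * R], where rectangles are known to be compact. *)
Lemma rectangle_pullback_continuous (k : R[i] -> R) l1 r1 l2 r2 :
  (forall z, rectangle l1 r1 l2 r2 z -> forall e, 0 < e -> exists2 d, 0 < d &
    forall w, rectangle l1 r1 l2 r2 w -> normc (w - z) < d -> `|k w - k z| < e) ->
  {within (`[l1, r1] `*` `[l2, r2] : set (R * R)),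
     continuous (fun z => k (z.1 +i* z.2))}.
Proof.
move=> ck; apply/subspace_continuousP => -[x y] [/= hx hy].
rewrite !in_itv/= in hx hy.
have rz : rectangle l1 r1 l2 r2 (x +i* y) by [].
apply/cvgrPdist_lt => eps eps0; rewrite near_withinE.
have [d d0 Hd] := ck _ rz _ eps0.
exists (ball x (d / 2), ball y (d / 2)) => /=.
  by split; apply: nbhsx_ballx; rewrite divr_gt0.
move=> [x' y'] [/= h1 h2] [/= hx' hy']; rewrite !in_itv/= in hx' hy'.
have le2 : normc ((x' +i* y') - (x +i* y)) <= `|x' - x| + `|y' - y|
  by exact: normc_le_ReIm.
move: h1 h2; rewrite /ball/= (distrC x) (distrC y) => h1 h2.
have hd : `|x' - x| + `|y' - y| < d by lra.
rewrite distrC; apply: Hd => //; exact: le_lt_trans le2 hd.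
Qed.

(** If [Re g] were positive inside, adding a small multiple of [|z - l|^2], with
    [l] the lower left corner, would keep the maximum inside.  Up to an affine
    function, which is the real part of a holomorphic one, this square is
    [|z - z1|^2] for the point [z1] where the maximum is attained; so a
    holomorphic function would have a real part with a strict local maximum. *)
Lemma Re_maximum_principle g l1 r1 l2 r2 :
  (forall z, open_rectangle l1 r1 l2 r2 z -> derivable g z 1) ->
  {within rectangle l1 r1 l2 r2, continuous g} ->
  (forall z, rectangle_boundary l1 r1 l2 r2 z -> complex.Re (g z) <= 0) ->
  forall z, rectangle l1 r1 l2 r2 z -> complex.Re (g z) <= 0.
Proof.
move=> dg cg bg [x0 y0] rz0; rewrite leNgt; apply/negP => m0.
set m := complex.Re _ in m0.
pose w x y := (x - l1) ^+ 2 + (y - l2) ^+ 2.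
pose D := w r1 r2 + 1.
have D0 : 0 < D by rewrite ltr_wpDl// addr_ge0// sqr_ge0.
have wD x y : rectangle l1 r1 l2 r2 (x +i* y) -> w x y <= D.
  move=> [/= /andP[h1 h2] /andP[h3 h4]]; apply: le_trans (_ : w r1 r2 <= D).
    by apply: lerD; rewrite ler_sqr ?nnegrE ?subr_ge0 ?lerD2r//
      (le_trans h1 h2, le_trans h3 h4).
  by rewrite lerDl.
(* the quadratic term is at most m / 2, so it cannot lift the boundary values
   up to m *)
pose e := m / (2 * D).
have e0 : 0 < e by rewrite divr_gt0// mulr_gt0.
have eD : e * D = m / 2 by rewrite /e; field; rewrite gt_eqF.
pose a x y := complex.Re (g (x +i* y)); pose b x y := complex.Im (g (x +i* y)).
pose E x y := a x y + e * w x y.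
pose S : set (R * R) := `[l1, r1] `*` `[l2, r2].
have inS x y : S (x, y) <-> rectangle l1 r1 l2 r2 (x +i* y).
  by rewrite /S /rectangle /= !in_itv/=.
have [|||[x1 y1]] := @compact_EVT_max _ R (fun z : R * R => E z.1 z.2) S.
- by exists (x0, y0); apply/inS.
- apply: compact_setX; exact: segment_compact.
- have cR : {within S, continuous (fun z : R * R => complex.Re (g (z.1 +i* z.2)))}.
    apply: (@rectangle_pullback_continuous (fun z => complex.Re (g z))) => z rz eps eps0.
    have /within_continuous_epsP /(_ _ rz _ eps0)[d d0 Hd] := cg.
    exists d => // w' rw wz; apply: le_lt_trans (Hd w' rw wz).
    by apply: le_trans (Re_le_normc _); rewrite ReD ReN.
  apply/subspace_continuousP => -[x y] Sz.
  have cx : z.1 @[z --> within S (nbhs (x, y))] --> x.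
    by apply: cvg_within_filter; exact: cvg_fst.
  have cy : z.2 @[z --> within S (nbhs (x, y))] --> y.
    by apply: cvg_within_filter; exact: cvg_snd.
  apply: cvgD; first by have /subspace_continuousP := cR; apply.
  apply: cvgM; first exact: cvg_cst.
  apply: cvgD; rewrite expr2; apply: cvgM; apply: cvgB => //; exact: cvg_cst.
rewrite inE => /inS rz1 mE.
have mE' x y : rectangle l1 r1 l2 r2 (x +i* y) -> E x y <= E x1 y1.
  by move=> /inS h; apply: (mE (x, y)); rewrite inE.
have m1 : m <= E x1 y1.
  apply: le_trans (mE' _ _ rz0).
  by rewrite /E /a -/m lerDl mulr_ge0 ?(ltW e0)// /w addr_ge0// sqr_ge0.
have nb : ~ rectangle_boundary l1 r1 l2 r2 (x1 +i* y1).
  move=> /bg b1; have := ler_wpM2l (ltW e0) (wD _ _ rz1).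
  by move: m1 b1; rewrite /E /a eD; lra.
have o1 : open_rectangle l1 r1 l2 r2 (x1 +i* y1).
  move: rz1 => [/= /andP[h1 h2] /andP[h3 h4]].
  have bd P : (P -> rectangle_boundary l1 r1 l2 r2 (x1 +i* y1)) -> ~ P by move=> h /h.
  split; apply/andP; split; rewrite lt_neqAle ?h1 ?h2 ?h3 ?h4 andbT;
    apply/eqP; apply: bd => eq; split; rewrite /rectangle /= ?h1 ?h2 ?h3 ?h4//.
  - by constructor 1.
  - by constructor 2.
  - by constructor 3.
  - by constructor 4.
have [r r0 Hr] : exists2 r, 0 < r & forall x y,
    `|x - x1| <= 2 * r -> `|y - y1| <= 2 * r ->
    open_rectangle l1 r1 l2 r2 (x +i* y).
  move: o1 => [/= /andP[h1 h2] /andP[h3 h4]].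
  exists (Num.min (Num.min (x1 - l1) (r1 - x1)) (Num.min (y1 - l2) (r2 - y1)) / 4).
    by rewrite divr_gt0// !lt_min !subr_gt0 h1 h2 h3.
  set mm := Num.min _ _.
  have [k1 k2 k3 k4] : [/\ mm <= x1 - l1, mm <= r1 - x1, mm <= y1 - l2 & mm <= r2 - y1].
    by split; rewrite /mm !ge_min lexx ?orbT.
  have mm0 : 0 < mm by rewrite /mm !lt_min !subr_gt0 h1 h2 h3.
  move=> x y; rewrite !ler_norml => /andP[q1 q2] /andP[q3 q4].
  by split => /=; apply/andP; split; lra.
(* completing the square at (x1, y1) leaves this linear form, the real part of
   a holomorphic function with imaginary part - k2 x + k1 y *)
pose k1 := 2 * e * (x1 - l1); pose k2 := 2 * e * (y1 - l2).
apply: (@no_strict_maximum R (fun x y => a x y + (k1 * x + k2 * y))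
   (fun x y => b x y + (- k2 * x + k1 * y)) x1 y1 r e r0 e0).
  move=> x y hx hy; have [al [be [da db]]] := derivable_has_gradient (dg _ (Hr x y hx hy)).
  exists (al + k1), (be - k2); split; last exact: has_gradient_affine.
  by rewrite (_ : - (be - k2) = - be + k2); [exact: has_gradient_affine|ring].
move=> x y hx hy.
have [] := Hr x y; [lra|lra|move=> /andP[q1 q2] /andP[q3 q4]].
have := mE' x y; rewrite /rectangle /= (ltW q1) (ltW q2) (ltW q3) (ltW q4).
move=> /(_ (conj isT isT)).
by rewrite /E /w /k1 /k2; lra.
Qed.

(** Given a point, rotate [Y] so that its value there becomes its modulus, and
    apply [Re_maximum_principle] to the difference with [V]. *)
Lemma modulus_majorant Y V l1 r1 l2 r2 :
  (forall z, open_rectangle l1 r1 l2 r2 z -> derivable Y z 1) ->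
  (forall z, open_rectangle l1 r1 l2 r2 z -> derivable V z 1) ->
  {within rectangle l1 r1 l2 r2, continuous Y} ->
  {within rectangle l1 r1 l2 r2, continuous V} ->
  (forall z, rectangle_boundary l1 r1 l2 r2 z -> normc (Y z) <= complex.Re (V z)) ->
  forall z, rectangle l1 r1 l2 r2 z -> normc (Y z) <= complex.Re (V z).
Proof.
move=> dY dV cY cV bd z rz.
have [c c1 cz] : exists2 c : R[i], normc c = 1 & complex.Re (c * Y z) = normc (Y z).
  have [z0|nz] := eqVneq (Y z) 0.
    by exists 1; [rewrite normcE /= expr1n expr0n/= addr0 sqrtr1|rewrite z0 mulr0 normc0].
  exists (`|Y z| / Y z); last by rewrite divfK// normc_norm.
  rewrite normcM normcV normc_norm normcE/= expr0n/= addr0 sqrtr_sqr.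
  by rewrite ger0_norm ?normc_ge0// mulfV// normc_eq0.
have := @Re_maximum_principle (fun w => c * Y w - V w) l1 r1 l2 r2.
move=> /(_ _ _ _ z rz); rewrite ReD ReN cz subr_le0; apply.
- move=> w ow; apply: derivableB; last exact: dV.
  by apply: derivableM; [exact: derivable_cst|exact: dY].
- move=> w; apply: cvgB; last exact: cV.
  by apply: cvgM; [exact: cvg_cst|exact: cY].
- move=> w bw; rewrite ReD ReN subr_le0; apply: le_trans (bd w bw).
  apply: le_trans (ler_norm _) _; apply: le_trans (Re_le_normc _) _.
  by rewrite normcM c1 mul1r.
Qed.

End RectangleMaximum.

(** * Exponentials and powers of difference quotients *)

Section ComplexExponential.
Variable R : realType.
Local Open Scope classical_set_scope.
Local Open Scope complex_scope.
Implicit Types (g s : R[i] -> R[i]) (z w : R[i]) (x y h e d M X Y C : R).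
Local Notation normc := ComplexField.Normc.normc.

Definition cexp z : R[i] :=
  (expR (complex.Re z) * cos (complex.Im z)) +i*
  (expR (complex.Re z) * sin (complex.Im z)).

Lemma normc_cexp z : normc (cexp z) = expR (complex.Re z).
Proof.
rewrite normcE /= !exprMn -mulrDr cos2Dsin2 mulr1 sqrtr_sqr ger0_norm//.
Qed.

Lemma cexpD z w : cexp (z + w) = cexp z * cexp w.
Proof.
apply/eqP; rewrite eq_complex ReM ImM /= ReD ImD expRD cosD sinD.
by apply/andP; split; apply/eqP; ring.
Qed.

Lemma cexp_near0 e : 0 < e -> exists2 d, 0 < d &
  forall w, normc w < d -> normc (cexp w - (1 + w)) <= e * normc w.
Proof.
move=> e0.
have near0 (f : R -> R) (df : R) : is_derive (0 : R) 1 f df ->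
    forall e, 0 < e -> exists2 d : R, 0 < d &
    forall t : R, `|t| < d -> `|f t - (f 0 + df * t)| <= e * `|t|.
  move=> /is_derive_epsP H eps eps0; have [d d0 Hd] := H _ eps0.
  by exists d => // t; have := Hd t; rewrite subr0.
pose e1 := Num.min (e / 8) (1 / 2).
have [e10 e1e e11] : [/\ 0 < e1, e1 <= e / 8 & e1 <= 1 / 2].
  by rewrite /e1 lt_min !ge_min !lexx orbT divr_gt0//; split => //; lra.
have [dexp dexp0 Hexp] := near0 _ _ (is_derive_expR 0) e1 e10.
have [dcos dcos0 Hcos] := near0 _ _ (is_derive_cos 0) e1 e10.
have [dsin dsin0 Hsin] := near0 _ _ (is_derive_sin 0) e1 e10.
exists (Num.min (Num.min dexp dcos) (Num.min dsin (e1 / 2))).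
  by rewrite !lt_min dexp0 dcos0 dsin0 divr_gt0.
case=> x y; rewrite !lt_min => /andP[/andP[h1 h2] /andP[h3 h4]].
have xw : `|x| <= normc (x +i* y) by exact: (Re_le_normc (x +i* y)).
have yw : `|y| <= normc (x +i* y) by exact: (Im_le_normc (x +i* y)).
have := Hexp x (le_lt_trans xw h1); have := Hcos y (le_lt_trans yw h2).
have := Hsin y (le_lt_trans yw h3).
rewrite expR0 cos0 sin0 mul1r oppr0 mul0r addr0 add0r mul1r.
set r := normc _ in xw yw h4 *; move=> Is Ic Ie.
have r0 : 0 <= r by exact: normc_ge0.
have ex1 : `|expR x - 1| <= e1.
  have -> : expR x - 1 = expR x - (1 + x) + x by ring.
  apply: le_trans (ler_normD _ _) _.
  have : e1 * `|x| <= 1 / 2 * `|x| by rewrite ler_wpM2r.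
  by lra.
have ex2 : `|expR x| <= 2.
  have -> : expR x = expR x - 1 + 1 by ring.
  by apply: le_trans (ler_normD _ _) _; rewrite normr1; lra.
have siny : `|sin y| <= 2 * `|y|.
  have -> : sin y = sin y - y + y by ring.
  apply: le_trans (ler_normD _ _) _.
  have : e1 * `|y| <= 1 / 2 * `|y| by rewrite ler_wpM2r.
  by have := normr_ge0 y; lra.
apply: le_trans (normc_le_ReIm _) _; rewrite !(ReD, ImD, ReN, ImN) /= add0r.
have -> : expR x * cos y - (1 + x) = (expR x - (1 + x)) + expR x * (cos y - 1) by ring.
have -> : expR x * sin y - y = (sin y - y) + (expR x - 1) * sin y by ring.
have b1 : `|expR x * (cos y - 1)| <= 2 * (e1 * `|y|) by rewrite normrM ler_pM.
have b2 : `|(expR x - 1) * sin y| <= e1 * (2 * `|y|) by rewrite normrM ler_pM.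
apply: le_trans (lerD (ler_normD _ _) (ler_normD _ _)) _.
apply: (@le_trans _ _ (e1 * (`|x| + 5 * `|y|))); first by lra.
apply: (@le_trans _ _ (e1 * (6 * r))); first by rewrite ler_pM2l//; lra.
by rewrite mulrA ler_wpM2r//; lra.
Qed.

Lemma derivable_continuous_at g z : derivable g z 1 -> {for z, continuous g}.
Proof.
by move=> dg; apply/differentiable_continuous/derivable1_diffP.
Qed.

Lemma derivable_within_cont (A : set R[i]) g :
  (forall z, A z -> derivable g z 1) -> {within A, continuous g}.
Proof.
move=> dg; apply: continuous_in_subspaceT => z; rewrite inE => Az.
exact: derivable_continuous_at (dg z Az).
Qed.

Lemma derivable_cexp_comp s z : derivable s z 1 ->
  derivable (fun w => cexp (s w)) z 1.
Proof.
move=> ds; have cs := derivable_continuous_at ds.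
move: ds => /derivable_epsP[d H]; apply/derivable_epsP.
exists (cexp (s z) * d) => e e0.
pose c := expR (complex.Re (s z)).
have c0 : 0 < c by exact: expR_gt0.
pose e1 := Num.min 1 (e / (c * (normc d + 2))).
have nd : 0 < normc d + 2 by have := normc_ge0 d; lra.
have e10 : 0 < e1 by rewrite lt_min ltr01 divr_gt0// mulr_gt0.
have e11 : e1 <= 1 by rewrite ge_min lexx.
have e12 : e1 * (c * (normc d + 2)) <= e.
  by rewrite -ler_pdivlMr ?mulr_gt0// ge_min lexx orbT.
have [r1 r10 H1] := H e1 e10; have [r2 r20 H2] := cexp_near0 e10.
have M0 : 0 < normc d + 1 by have := normc_ge0 d; lra.
exists (Num.min r1 (r2 / (normc d + 1))); first by rewrite lt_min r10 divr_gt0.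
move=> w; rewrite lt_min => /andP[w1 w2].
have b1 := H1 w w1.
have n0 := normc_ge0 (w - z).
have b2 : normc (s w - s z) <= (normc d + 1) * normc (w - z).
  have -> : s w - s z = (s w - (s z + d * (w - z))) + d * (w - z) by ring.
  apply: le_trans (normc_D _ _) _; rewrite normcM.
  have : e1 * normc (w - z) <= 1 * normc (w - z) by rewrite ler_wpM2r.
  by lra.
have w2' : (normc d + 1) * normc (w - z) < r2.
  by rewrite mulrC -ltr_pdivlMr.
have b3 := H2 (s w - s z) (le_lt_trans b2 w2').
have -> : cexp (s w) - (cexp (s z) + cexp (s z) * d * (w - z)) =
    cexp (s z) * ((cexp (s w - s z) - (1 + (s w - s z))) +
                  (s w - (s z + d * (w - z)))).
  have -> : cexp (s w) = cexp (s z) * cexp (s w - s z) by rewrite -cexpD subrKC.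
  by ring.
rewrite normcM normc_cexp -/c.
apply: (@le_trans _ _ (c * (e1 * (normc d + 2) * normc (w - z)))).
  rewrite ler_pM2l//; apply: le_trans (normc_D _ _) _.
  have : e1 * normc (s w - s z) <= e1 * ((normc d + 1) * normc (w - z)).
    by rewrite ler_pM2l.
  by lra.
by rewrite mulrA ler_wpM2r// mulrCA.
Qed.

(** Taking [n]-th roots would make the constant [C] disappear; Bernoulli's
    inequality replaces roots. *)
Lemma power_growth X Y C : 0 <= X -> 0 <= Y ->
  (forall n, X ^+ n.+1 <= C * Y ^+ n) -> X <= Y.
Proof.
move=> X0 Y0 H; rewrite leNgt; apply/negP => YX.
have [Yz|Yn] := eqVneq Y 0.
  have := H 1%N; rewrite Yz expr1 mulr0 leNgt => /negP; apply.
  by rewrite exprn_gt0// -Yz.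
have Yp : 0 < Y by rewrite lt_neqAle eq_sym Yn.
pose t := X / Y - 1.
have t0 : 0 < t by rewrite /t subr_gt0 ltr_pdivlMr// mul1r.
have bern n : 1 + n%:R * t <= (1 + t) ^+ n.
  elim: n => [|n IH]; first by rewrite mul0r addr0 expr0.
  rewrite exprSr; apply: (@le_trans _ _ ((1 + n%:R * t) * (1 + t))).
    have : 0 <= n%:R * (t * t) by rewrite mulr_ge0// mulr_ge0// ltW.
    by rewrite -natr1; lra.
  by rewrite ler_wpM2r//; lra.
have Xp : 0 < X by apply: lt_trans YX.
have bnd n : X * (n%:R * t) <= C.
  have := H n; have -> : X ^+ n.+1 = X * (1 + t) ^+ n * Y ^+ n.
    rewrite exprS -mulrA -exprMn; congr (_ * _ ^+ _).
    by rewrite /t; field.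
  rewrite ler_pM2r ?exprn_gt0//; apply: le_trans.
  by rewrite ler_pM2l//; apply: le_trans (bern n); rewrite lerDr.
have C0 : 0 <= C by have := bnd 0%N; rewrite mul0r mulr0.
have := bnd (Num.bound (C / (X * t))); rewrite leNgt => /negP; apply.
have Xt : 0 < X * t by rewrite mulr_gt0.
have := archi_boundP (divr_ge0 C0 (ltW Xt)).
by rewrite ltr_pdivrMr// mulrCA.
Qed.

Lemma cderivable_cst (c : R[i]) z : derivable (fun _ => c) z 1.
Proof. exact: derivable_cst. Qed.

Lemma cderivable_id z : derivable (fun w : R[i] => w) z 1.
Proof. exact: derivable_id. Qed.

Lemma cderivableD g s z : derivable g z 1 -> derivable s z 1 ->
  derivable (fun w => g w + s w) z 1.
Proof. by move=> dg ds; apply: derivableD; [exact: dg|exact: ds]. Qed.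

Lemma cderivableB g s z : derivable g z 1 -> derivable s z 1 ->
  derivable (fun w => g w - s w) z 1.
Proof. by move=> dg ds; apply: derivableB; [exact: dg|exact: ds]. Qed.

Lemma cderivableM g s z : derivable g z 1 -> derivable s z 1 ->
  derivable (fun w => g w * s w) z 1.
Proof. by move=> dg ds; apply: derivableM; [exact: dg|exact: ds]. Qed.

Lemma cderivableV g z : g z != 0 -> derivable g z 1 ->
  derivable (fun w => (g w)^-1) z 1.
Proof. by move=> gz dg; apply: derivableV. Qed.

Lemma cderivable_pow g n z : derivable g z 1 ->
  derivable (fun w => g w ^+ n) z 1.
Proof.
move=> dg; elim: n => [|n IH].
  under eq_fun do rewrite expr0.
  exact: cderivable_cst.
under eq_fun do rewrite exprS.
exact: cderivableM.
Qed.

(** The function is [(w - z) * q w ^+ n.+1] where [q] is the difference quotient of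
    [g] at [z].  As the inverse of 0 is 0, its value at [z] is 0, and its own
    difference quotient there is [q ^+ n.+1], which converges. *)
Lemma difference_power_derivable g z n w : derivable g w 1 ->
  derivable (fun w => (g w - g z) ^+ n.+1 * (w - z)^-1 ^+ n) w 1.
Proof.
move=> dg; have [wz|wz] := eqVneq w z; last first.
  apply: cderivableM; apply: cderivable_pow.
    by apply: cderivableB; [exact: dg|exact: cderivable_cst].
  apply: cderivableV; first by rewrite subr_eq0.
  by apply: cderivableB; [exact: cderivable_id|exact: cderivable_cst].
rewrite {w}wz in dg *.
move: dg => /cvg_ex[/= d cv]; apply/cvg_ex; exists (d ^+ n.+1).
set Q := (Q in Q @ _ --> d) in cv.
have cQ m : (fun k : R[i] => Q k ^+ m) @ 0^' --> d ^+ m.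
  elim: m => [|m IH].
    by rewrite (_ : (fun k => _) = cst 1); [exact: cvg_cst|apply/funext => k; rewrite expr0].
  rewrite (_ : (fun k => _) = (fun k => Q k * Q k ^+ m)).
    by rewrite exprS; apply: cvgM; [exact: cv|exact: IH].
  by apply/funext => k; rewrite exprS.
apply: cvg_trans (cQ n.+1); apply: near_eq_cvg; near=> k.

rewrite /Q /GRing.scale/=. rewrite mulr1 subrr expr0n/= mul0r subr0 addrK.
by rewrite exprMn exprS; ring.
Unshelve. all: by end_near.
Qed.

End ComplexExponential.

(** * A gradient estimate and sums of poles over a grid *)

Section KernelSums.
Variable R : realType.
Local Open Scope classical_set_scope.
Local Open Scope complex_scope.
Implicit Types (g s : R[i] -> R[i]) (z w : R[i]) (x y h e d t M r : R).
Local Notation normc := ComplexField.Normc.normc.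

Lemma normcX z n : normc (z ^+ n) = normc z ^+ n.
Proof.
elim: n => [|n IH]; last by rewrite !exprS normcM IH.
by rewrite !expr0 normcE /= expr1n expr0n/= addr0 sqrtr1.
Qed.

(** A Schwarz lemma for squares.  The difference quotient [q] of [g] at [z] is at
    most [2 * M / r] on the boundary of the square, but it has a puncture at
    [z].  The maximum principle is therefore applied to [(w - z) * q w ^+ n.+1],
    which has none, and the extra factor disappears as [n] grows. *)
Lemma gradient_estimate g z M r : 0 < r ->
  (forall w, `|complex.Re w - complex.Re z| <= r ->
     `|complex.Im w - complex.Im z| <= r -> derivable g w 1 /\ normc (g w) <= M) ->
  forall w, `|complex.Re w - complex.Re z| <= r ->
     `|complex.Im w - complex.Im z| <= r ->
  normc (g w - g z) <= 2 * M / r * normc (w - z).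
Proof.
move=> r0 H w wx wy.
pose Q := rectangle (complex.Re z - r) (complex.Re z + r)
  (complex.Im z - r) (complex.Im z + r).
have inQ v : Q v <-> `|complex.Re v - complex.Re z| <= r /\
    `|complex.Im v - complex.Im z| <= r.
  rewrite /Q /rectangle /= !ler_norml; split => -[/andP[h1 h2] /andP[h3 h4]];
  by split; apply/andP; split; lra.
have [||_ gzM] := H z; [by rewrite subrr normr0 ltW|by rewrite subrr normr0 ltW|].
have M0 : 0 <= M by apply: le_trans gzM; exact: normc_ge0.
apply: (@power_growth _ _ _ (2 * M)); rewrite ?normc_ge0//.
  by rewrite mulr_ge0 ?normc_ge0// divr_ge0 ?(ltW r0)// mulr_ge0.
move=> n.
pose Y v := (g v - g z) ^+ n.+1 * (v - z)^-1 ^+ n.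
have dY v : Q v -> derivable Y v 1.
  by move=> /inQ[h1 h2]; apply: difference_power_derivable; have [] := H v h1 h2.
pose C := (2 * M) ^+ n.+1 / r ^+ n.
have C0 : 0 <= C by rewrite divr_ge0// exprn_ge0 ?(ltW r0)// mulr_ge0.
have oQ v : open_rectangle (complex.Re z - r) (complex.Re z + r)
  (complex.Im z - r) (complex.Im z + r) v -> Q v.
  by move=> [/andP[h1 h2] /andP[h3 h4]]; split; apply/andP; split; rewrite ltW.
have YC : normc (Y w) <= C.
  apply: (@modulus_majorant R Y (fun=> C%:C) (complex.Re z - r) (complex.Re z + r)
    (complex.Im z - r) (complex.Im z + r)).
  - by move=> v /oQ; exact: dY.
  - by move=> v _; exact: cderivable_cst.
  - by apply: derivable_within_cont => v; exact: dY.
  - by apply: derivable_within_cont => v _; exact: cderivable_cst.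
  - move=> v [/inQ[hx hy] bd] /=.
    have far : r <= normc (v - z).
      have rx : complex.Re v - complex.Re z = complex.Re (v - z) by rewrite ReD ReN.
      have ry : complex.Im v - complex.Im z = complex.Im (v - z) by rewrite ImD ImN.
      case: bd => eq; rewrite eq in hx hy rx ry.
      - apply: le_trans (Re_le_normc _); rewrite -rx addrAC subrr add0r.
        by rewrite normrN ler_norm.
      - by apply: le_trans (Re_le_normc _); rewrite -rx addrAC subrr add0r ler_norm.
      - apply: le_trans (Im_le_normc _); rewrite -ry addrAC subrr add0r.
        by rewrite normrN ler_norm.
      - by apply: le_trans (Im_le_normc _); rewrite -ry addrAC subrr add0r ler_norm.
    have [_ gvM] := H v hx hy.
    rewrite /Y /C normcM !normcX normcV ler_pM ?exprn_ge0 ?invr_ge0 ?normc_ge0//.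
      rewrite lerXn2r ?nnegrE ?normc_ge0 ?mulr_ge0//.
      by apply: le_trans (normc_D _ _) _; rewrite normcN; lra.
    rewrite -exprVn lerXn2r ?nnegrE ?invr_ge0 ?normc_ge0 ?(ltW r0)//.
    by rewrite lef_pV2 ?posrE// (lt_le_trans r0 far).
  - exact/inQ.
have [->|wz] := eqVneq w z.
  have k0 : 0 <= 2 * M / r * normc (z - z).
    by rewrite mulr_ge0 ?normc_ge0// divr_ge0 ?(ltW r0)// mulr_ge0.
  by rewrite subrr normc0 exprS mul0r mulr_ge0 ?mulr_ge0// exprn_ge0// -(subrr z).
have wz0 : 0 < normc (w - z) by rewrite normc_gt0 subr_eq0.
move: YC; rewrite /Y normcM !normcX normcV exprVn ler_pdivrMr ?exprn_gt0//.
move/le_trans; apply; rewrite /C le_eqVlt; apply/orP; left; apply/eqP.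
by rewrite !exprMn exprVn (exprS 2) (exprS M); ring.
Qed.

(** [i / (z - (t - i h))], whose real part is, up to the factor [pi], the Poisson
    kernel of the upper half-plane at [z + i h] and [t]. *)
Definition pole h t z : R[i] := (0 +i* 1) / (z - (t +i* (- h))).

Lemma Re_pole h t x y : complex.Re (pole h t (x +i* y)) =
  (y + h) / ((x - t) ^+ 2 + (y + h) ^+ 2).
Proof. by rewrite /pole ReM /= mul0r sub0r mul1r !opprK. Qed.

Lemma pole_derivable h t z : 0 < h -> 0 <= complex.Im z ->
  derivable (pole h t) z 1.
Proof.
move=> h0 z0; apply: cderivableM; first exact: cderivable_cst.
apply: cderivableV.
  by rewrite eq_complex ImD ImN /= opprK negb_and orbC gt_eqF// ltr_wpDl.
by apply: cderivableB; [exact: cderivable_id|exact: cderivable_cst].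
Qed.

Definition poles K h (t c : nat -> R) z : R[i] :=
  \sum_(i < K) (c i)%:C * pole h (t i) z.

Lemma Re_poles K h (t c : nat -> R) x y : complex.Re (poles K h t c (x +i* y)) =
  \sum_(i < K) c i * ((y + h) / ((x - t i) ^+ 2 + (y + h) ^+ 2)).
Proof.
rewrite /poles; elim: K => [|K IH]; first by rewrite !big_ord0.
by rewrite !big_ord_recr /= ReD IH ReM Re_pole /= mul0r subr0.
Qed.

Lemma poles_derivable K h (t c : nat -> R) z : 0 < h -> 0 <= complex.Im z ->
  derivable (poles K h t c) z 1.
Proof.
move=> h0 z0; rewrite /poles; elim: K => [|K IH].
  by under eq_fun do rewrite big_ord0; exact: cderivable_cst.
under eq_fun do rewrite big_ord_recr /=.
apply: cderivableD; first exact: IH.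
by apply: cderivableM; [exact: cderivable_cst|exact: pole_derivable].
Qed.

Lemma sum_telescope K (F : nat -> R) : \sum_(i < K) (F i.+1 - F i) = F K - F 0%N.
Proof.
by elim: K => [|K IH]; rewrite ?big_ord0 ?subrr// big_ord_recr /= IH; ring.
Qed.

Lemma sum_two_steps K (F : nat -> R) : (forall i, F i <= F i.+1) ->
  \sum_(i < K) (F i.+2 - F i) <= 2 * (F K.+1 - F 0%N).
Proof.
move=> ndF.
have -> : \sum_(i < K) (F i.+2 - F i) =
    \sum_(i < K) (F i.+2 - F i.+1) + \sum_(i < K) (F i.+1 - F i).
  by rewrite -big_split /=; apply: eq_bigr => i _; ring.
rewrite (sum_telescope K F) (sum_telescope K (fun i => F i.+1)).
by have := ndF K; have := ndF 0%N; lra.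
Qed.

(** The terms are values of [1 / (1 + u^2)] at points with unit spacing; each is
    at most three times the next increment of [atan], whose total increment is
    below [pi]. *)
Lemma discrete_poisson_bound K h (N x : R) : 0 < h ->
  \sum_(i < K) h * (h / ((x - (N + i%:R * h)) ^+ 2 + h ^+ 2)) <= 3 * pi.
Proof.
move=> h0.
pose u i := (N + i%:R * h - x) / h.
have uS i : u i.+1 = u i + 1.
  by rewrite /u -natr1; field; rewrite gt_eqF.
apply: (@le_trans _ _ (\sum_(i < K) (3 * atan (u i.+1) - 3 * atan (u i)))).
  apply: ler_sum => i _.
  have -> : h * (h / ((x - (N + i%:R * h)) ^+ 2 + h ^+ 2)) = (1 + u i ^+ 2)^-1.
    have -> : x - (N + i%:R * h) = - (u i * h) by rewrite /u; field; rewrite gt_eqF.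
    have p0 : 0 < 1 + u i ^+ 2 by rewrite ltr_wpDr// sqr_ge0.
    have -> : (- (u i * h)) ^+ 2 + h ^+ 2 = (1 + u i ^+ 2) * (h * h) by ring.
    by field; rewrite (gt_eqF p0) (gt_eqF h0).
  have uu : u i < u i.+1 by rewrite uS ltrDl.
  have [|c] := @MVT R atan (fun v : R => (1 + v ^+ 2)^-1) (u i) (u i.+1) uu.
    by apply: continuous_subspaceT => v; exact: continuous_atan.
  rewrite in_itv /= => /andP[c1 c2]; rewrite -mulrBr => ->.
  rewrite uS in c2 *; rewrite (addrC (u i)) addrK mulr1.
  have p0 : 0 < 1 + u i ^+ 2 by rewrite ltr_wpDr// sqr_ge0.
  have q0 : 0 < 1 + c ^+ 2 by rewrite ltr_wpDr// sqr_ge0.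
  rewrite -ler_pdivrMl// -invfM lef_pV2 ?posrE ?mulr_gt0//.
  have -> : c = u i + (c - u i) by ring.
  set d := c - u i.
  have d0 : 0 <= d by rewrite /d; lra.
  have d1 : d ^+ 2 <= 1 by rewrite expr_le1//; rewrite /d; lra.
  have := sqr_ge0 (u i - d); move: d1; clearbody d; move: (u i) => v d1 h1.
  by have := sqr_ge0 v; lra.
rewrite (sum_telescope K (fun i => 3 * atan (u i))) -mulrBr ler_pM2l//.
by have := atan_ltpi2 (u K); have := atan_gtNpi2 (u 0%N); lra.
Qed.

(** Clamping the grid points to [[a, b]] changes none of the terms that are
    counted and makes the sum telescope. *)
Lemma grid_variation_near K h (La : R -> R) (N a b a' b' : R) : 0 < h ->
  {homo La : x y / x <= y} -> a <= b -> a + h <= a' -> b' + h + h <= b ->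
  \sum_(i < K) ((a' < N + i%:R * h + h) && (N + i%:R * h < b'))%:R *
     (La (N + i%:R * h + h + h) - La (N + i%:R * h)) <= 2 * (La b - La a).
Proof.
move=> h0 ndLa ab aa' bb'.
pose c x := Num.max a (Num.min x b).
have cab x : a <= c x <= b.
  by rewrite /c le_max lexx /= ge_max ab ge_min lexx orbT.
pose F i := La (c (N + i%:R * h)).
have NS i : N + i.+1%:R * h = N + i%:R * h + h by rewrite -natr1; ring.
have ndF i : F i <= F i.+1.
  apply: ndLa; rewrite /c ge_max le_max lexx /= le_max le_min !ge_min NS.
  by rewrite lerDl (ltW h0) /= lexx !orbT.
apply: (@le_trans _ _ (\sum_(i < K) (F i.+2 - F i))).
  apply: ler_sum => i _; case: (boolP (_ && _)) => [/andP[h1 h2]|_]; last first.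
    by rewrite mul0r subr_ge0; exact: le_trans (ndF i) (ndF i.+1).
  rewrite mul1r /F !NS /c !min_l ?max_r//; lra.
apply: le_trans (sum_two_steps _ ndF) _.
rewrite ler_pM2l// lerB// /F ndLa//.
  by have /andP[] := cab (N + K.+1%:R * h).
by have /andP[] := cab (N + 0%:R * h).
Qed.

(** The position of a grid point clamped to [[a + h, b]] advances by at most [h]
    per step, and only at grid points inside [(a, b)]. *)
Lemma grid_count K h (N a b : R) : 0 < h -> N <= a -> b <= N + K%:R * h ->
  b - a - h <= \sum_(i < K) ((a < N + i%:R * h) && (N + i%:R * h < b))%:R * h.
Proof.
move=> h0 Na bK.
pose F i := Num.max (a + h) (Num.min (N + i%:R * h) b).
have NS i : N + i.+1%:R * h = N + i%:R * h + h by rewrite -natr1; ring.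
apply: (@le_trans _ _ (F K - F 0%N)).
  rewrite /F (min_r bK) mul0r addr0.
  have -> : Num.max (a + h) (Num.min N b) = a + h.
    by rewrite max_l// ge_min; apply/orP; left; lra.
  have : b <= Num.max (a + h) b by rewrite le_max lexx orbT.
  by set M := Num.max _ _ => bM; lra.
rewrite -(sum_telescope K F); apply: ler_sum => i _.
rewrite /F NS; set x := N + _; clearbody x.
case: (ltP a x) => ax; case: (ltP x b) => xb; rewrite /= ?mul1r ?mul0r;
  case: (leP (x + h) b) => q2; case: (leP x b) => q1;
  rewrite !maxEle; do !case: ifPn; rewrite -?ltNge; lra.
Qed.

End KernelSums.

(** * Lavrentiev's estimate *)

Section LavrentievEstimate.
Variable R : realType.
Local Open Scope classical_set_scope.
Local Open Scope complex_scope.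
Implicit Types (g s : R[i] -> R[i]) (z w : R[i]) (x y h e d t m M r L tau : R).
Implicit Types (La : R -> R).
Local Notation normc := ComplexField.Normc.normc.

Lemma within_continuousM (A : set R[i]) g s : {within A, continuous g} ->
  {within A, continuous s} -> {within A, continuous (fun z => g z * s z)}.
Proof. by move=> cg cs z; apply: cvgM; [exact: cg|exact: cs]. Qed.

Lemma within_continuousB (A : set R[i]) g s : {within A, continuous g} ->
  {within A, continuous s} -> {within A, continuous (fun z => g z - s z)}.
Proof. by move=> cg cs z; apply: cvgB; [exact: cg|exact: cs]. Qed.

Lemma within_continuous_translate (A B : set R[i]) g c :
  (forall z, B z -> A (z + c)) -> {within A, continuous g} ->
  {within B, continuous (fun z => g (z + c))}.
Proof.
move=> BA /within_continuous_epsP cg; apply/within_continuous_epsP => z Bz e e0.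
have [d d0 Hd] := cg _ (BA z Bz) e e0; exists d => // w Bw wz.
by apply: Hd; [exact: BA|rewrite opprD addrACA subrr addr0].
Qed.

Lemma normc_real x : normc x%:C = `|x|.
Proof. by rewrite normcE /= expr0n/= addr0 sqrtr_sqr. Qed.

(** If [h] is below half the height of [z] this is [gradient_estimate]; otherwise
    the denominator [h] is itself comparable to the height. *)
Lemma difference_quotient_bound g m M h z : 1 <= m -> 0 < h -> h <= 1 ->
  (forall w, 0 < complex.Im w -> derivable g w 1) ->
  (forall w, `|complex.Re w| <= 8 * m -> 0 <= complex.Im w <= 8 * m ->
     normc (g w) <= M) ->
  `|complex.Re z| <= 4 * m -> 0 < complex.Im z <= 4 * m ->
  normc ((g (z + h%:C) - g z) / h%:C) <= 4 * M / complex.Im z.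
Proof.
move=> m1 h0 h1 dg bg zx /andP[y0 y4].
set y := complex.Im z in y0 y4 *.
have zx2 := zx; rewrite ler_norml in zx2; have /andP[x1 x2] := zx2.
have M0 : 0 <= M by apply: le_trans (bg z _ _); rewrite ?normc_ge0//; lra.
rewrite normcM normcV normc_real (gtr0_norm h0) ler_pdivrMr//.
have [hy|hy] := leP h (y / 2).
  have -> : 4 * M / y * h = 2 * M / (y / 2) * normc ((z + h%:C) - z).
    by rewrite addrC addKr normc_real (gtr0_norm h0); field; rewrite gt_eqF.
  apply: gradient_estimate; first by rewrite divr_gt0.
  - move=> w; rewrite !ler_norml => /andP[w1 w2] /andP[w3 w4].
    rewrite -/y in w3 w4; split; first by apply: dg; lra.
    apply: bg; first by rewrite ler_norml; apply/andP; split; lra.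
    by apply/andP; split; lra.
  - by rewrite ReD /= addrC addKr ger0_norm// ltW.
  - by rewrite ImD /= addr0 subrr normr0 divr_ge0 ?(ltW y0).
have b1 : normc (g (z + h%:C)) <= M.
  apply: bg; first by rewrite ReD /= ler_norml; apply/andP; split; lra.
  by rewrite ImD /= addr0; apply/andP; split; rewrite -/y; lra.
have b2 : normc (g z) <= M.
  apply: bg; first by rewrite ler_norml; apply/andP; split; lra.
  by apply/andP; split; rewrite -/y; lra.
apply: le_trans (normc_D _ _) _; rewrite normcN.
apply: (@le_trans _ _ (4 * M / y * (y / 2))).
  by rewrite (_ : 4 * M / y * (y / 2) = 2 * M); [lra|field; rewrite gt_eqF].
by rewrite ler_wpM2l ?(ltW hy)// divr_ge0 ?(ltW y0)// mulr_ge0.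
Qed.

Lemma cderivable_translate g z c : derivable g (z + c) 1 ->
  derivable (fun w => g (w + c)) z 1.
Proof.
move=> /derivable_epsP[d H]; apply/derivable_epsP; exists d => e e0.
have [r r0 Hr] := H e e0; exists r => // w wr.
have := Hr (w + c); have -> : w + c - (z + c) = w - z.
  by rewrite opprD addrACA subrr addr0.
exact.
Qed.

Lemma grid_locate K (N h t : R) : (0 < K)%N -> N <= t <= N + K%:R * h ->
  exists2 i, (i < K)%N & N + i%:R * h <= t <= N + i%:R * h + h.
Proof.
elim: K => // -[_ _|K IH _ /andP[t1 t2]].
  by rewrite mul1r => tb; exists 0%N; rewrite // mul0r addr0.
have [tK|Kt] := leP t (N + K.+1%:R * h).
  by have [||i iK ti] := IH; [|rewrite t1|exists i; rewrite // ltnS ltnW].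
exists K.+1; rewrite // (ltW Kt) /=; apply: le_trans t2 _.
by rewrite -(natr1 K.+1) mulrDl mul1r addrA.
Qed.

Lemma poles_far K h tau (t w : nat -> R) x : 0 < h -> 0 < tau ->
  (forall j, 0 <= w j <= 1) -> (forall j, w j = 0 \/ tau <= `|x - t j|) ->
  \sum_(j < K) w j * h * (h / ((x - t j) ^+ 2 + h ^+ 2)) <=
    K%:R * h * h / tau ^+ 2.
Proof.
move=> h0 tau0 w01 far.
have -> : K%:R * h * h / tau ^+ 2 = \sum_(j < K) h * h / tau ^+ 2.
  by rewrite sumr_const card_ord -[RHS]mulr_natl !mulrA.
apply: ler_sum => j _; have /andP[w0 w1] := w01 j.
case: (far j) => [->|fj].
  by rewrite !mul0r divr_ge0 ?sqr_ge0// mulr_ge0// ltW.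
apply: (@le_trans _ _ (h * (h / ((x - t j) ^+ 2 + h ^+ 2)))).
  rewrite -mulrA ler_piMl//.
  by rewrite mulr_ge0 ?(ltW h0)// divr_ge0 ?(ltW h0)// addr_ge0 ?sqr_ge0.
rewrite -mulrA ler_pM2l// ler_pM2l// lef_pV2 ?posrE ?exprn_gt0//; last first.
  by rewrite ltr_wpDl ?sqr_ge0// exprn_gt0.
apply: (@le_trans _ _ ((x - t j) ^+ 2)); last by rewrite lerDl sqr_ge0.
by rewrite -(real_normK (num_real (x - t j))) ler_sqr ?nnegrE ?(ltW tau0).
Qed.

(** Every step of length [2 h] is counted with weight [a], and those that come
    within [tau] of an interval with an additional weight [b]; both sums
    telescope. *)
Lemma weighted_grid_variation K n h tau (N a b : R) La (al be : 'I_n -> R) :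
  0 < h -> 2 * h <= tau -> 0 < a -> 0 < b -> {homo La : x y / x <= y} ->
  (forall l, al l <= be l) ->
  \sum_(i < K) (La (N + i%:R * h + h + h) - La (N + i%:R * h)) *
    (a + b * \sum_(l < n) ((al l - tau < N + i%:R * h + h) &&
                           (N + i%:R * h < be l + tau))%:R) <=
  2 * a * (La (N + K%:R * h + h) - La N) +
  2 * b * \sum_(l < n) (La (be l + 2 * tau) - La (al l - 2 * tau)).
Proof.
move=> h0 htau a0 b0 ndLa albe; pose t i := N + i%:R * h.
pose dLa i := La (t i + h + h) - La (t i).
have -> : \sum_(i < K) (La (N + i%:R * h + h + h) - La (N + i%:R * h)) *
    (a + b * \sum_(l < n) ((al l - tau < N + i%:R * h + h) &&
                           (N + i%:R * h < be l + tau))%:R) =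
    a * \sum_(i < K) dLa i + b * \sum_(l < n) \sum_(i < K)
      ((al l - tau < t i + h) && (t i < be l + tau))%:R * dLa i.
  rewrite exchange_big /= !mulr_sumr -big_split /=; apply: eq_bigr => i _.
  by rewrite mulrDr -/(dLa i) (mulrC (dLa i)) -mulr_suml; ring.
apply: lerD.
  rewrite (mulrC 2 a) -mulrA ler_pM2l//.
  have tS i : t i.+1 = t i + h by rewrite /t -natr1; ring.
  have -> : \sum_(i < K) dLa i = \sum_(i < K) (La (t i.+2) - La (t i)).
    by apply: eq_bigr => i _; rewrite /dLa !tS.
  apply: le_trans (sum_two_steps K (F := fun i => La (t i)) _) _.
    by move=> i; apply: ndLa; rewrite tS lerDl ltW.
  by rewrite tS /t mul0r addr0.
rewrite (mulrC 2 b) -[leRHS]mulrA ler_pM2l// mulr_sumr.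
apply: ler_sum => l _; have := albe l => ab.
by apply: grid_variation_near => //; clear -ab h0 htau; lra.
Qed.

(** The main estimate, for the rectangle with corners [- 4 m], [4 m],
    [4 m + 4 m i], [- 4 m + 4 m i] and the point [i m].  On the right,
    [144 * m * M] comes from the three sides off the real line, the total
    variation of [La] from the real side, and the last sum from the part of the
    real side within [tau] of the intervals.  On the left, [17 * m ^+ 2] is the
    modulus of [(i m - 4 m) * (i m + 4 m)].  The conditions that relate [h],
    [tau] and [L] say that the grid is so fine that farther than [tau] from the
    intervals the exponential is at most [exp 1]. *)
Lemma lavrentiev_estimate g La m M h tau L (K n : nat) (al be : 'I_n -> R) :
  1 <= m -> 0 < h -> K%:R * h = 8 * m -> h <= 1 -> 2 * h <= tau -> 0 <= L ->
  L * (8 * m * h) <= tau ^+ 2 ->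
  (forall w, 0 < complex.Im w -> derivable g w 1) ->
  {within [set w | 0 <= complex.Im w], continuous g} ->
  (forall w, `|complex.Re w| <= 8 * m -> 0 <= complex.Im w <= 8 * m ->
     normc (g w) <= M) ->
  {homo La : x y / x <= y} ->
  (forall t t', - (8 * m) <= t -> t <= t' -> t' <= 8 * m ->
     normc (g t'%:C - g t%:C) <= La t' - La t) ->
  (forall l, [/\ - m <= al l, al l <= be l & be l <= m]) ->
  (forall x, \sum_(l < n) ((al l < x) && (x < be l))%:R <= 1 :> R) ->
  normc ((g (0 +i* m + h%:C) - g (0 +i* m)) / h%:C) * (17 * m ^+ 2) *
    expR (L * ((\sum_(l < n) (be l - al l) - n%:R * h) * (4 / (45 * m)))) <=
  144 * m * M + 32 * m *
    (2 * expR 1 * (La (4 * m + 1) - La (- (4 * m))) +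
     2 * expR (3 * pi * L) *
       \sum_(l < n) (La (be l + 2 * tau) - La (al l - 2 * tau))).
Proof.
move=> m1 h0 Kh h1 htau L0 Ltau dg cg bg ndLa gLa albe disj.
have m0 : 0 < m by lra.
pose t i : R := - (4 * m) + i%:R * h.
have tK : t K = 4 * m by rewrite /t Kh; ring.
pose chi i : R := \sum_(l < n) ((al l < t i) && (t i < be l))%:R.
have chi0 i : 0 <= chi i by apply: sumr_ge0 => l _; exact: ler0n.
have chi1 i : chi i <= 1 by exact: disj.
have chiE i : chi i = 0 \/ exists l, al l < t i < be l.
  have [|ne] := pselect (exists l, al l < t i < be l); first by right.
  left; apply: big1 => l _; case: (boolP (_ && _)) => // h2.
  by case: ne; exists l.
(* up to the factor pi, the real part of P is a discrete Poisson extension of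
   the indicator of the intervals, taken at the height y + h; mu' is the length of the intervals as seen by the grid *)
pose mu' := \sum_(i < K) chi i * h.
have mu'0 : 0 <= mu' by apply: sumr_ge0 => i _; rewrite mulr_ge0// ltW.
pose P := poles K h t (fun i => chi i * h).
pose kap := mu' / (9 * m ^+ 2).
have kap0 : 0 <= kap by rewrite divr_ge0// mulr_ge0// exprn_ge0// ltW.
pose s z : R[i] := L%:C * (P z + kap%:C * ((0 +i* 1) * z - h%:C)).
have Res x y : complex.Re (s (x +i* y)) =
    L * (\sum_(i < K) chi i * h * ((y + h) / ((x - t i) ^+ 2 + (y + h) ^+ 2))
         - kap * (y + h)).
  by rewrite /s ReM ReD Re_poles ReM ReD ReN ReM /=; ring.
(* kap is chosen so that the linear term outweighs P wherever the poles that
   count are at distance at least 3 m *)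
have Res_le0 x y : 0 <= y ->
    (forall i, (exists l, al l < t i < be l) ->
       9 * m ^+ 2 <= (x - t i) ^+ 2 + (y + h) ^+ 2) ->
    complex.Re (s (x +i* y)) <= 0.
  move=> y0 far; rewrite Res mulr_ge0_le0// subr_le0.
  have yh : 0 < y + h by lra.
  have m9 : 0 < 9 * m ^+ 2 by rewrite mulr_gt0// exprn_gt0.
  rewrite /kap /mu' !mulr_suml; apply: ler_sum => i _.
  case: (chiE i) => [->|/far fi]; first by rewrite !mul0r.
  rewrite -!mulrA ler_wpM2l// ler_pM2l//.
  rewrite (mulrC (9 * m ^+ 2)^-1) ler_pM2l// lef_pV2 ?posrE//.
  exact: lt_le_trans m9 fi.
have chi_m i : (exists l, al l < t i < be l) -> - m <= t i <= m.
  by move=> [l /andP[l1 l2]]; have [a1 a2 a3] := albe l; apply/andP; split; lra.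
(* on the i-th cell the exponential is at most E i, and the weight W i makes a
   single term of V reach |Y| there *)
pose near i : R := \sum_(l < n)
  ((al l - tau < t i + h) && (t i < be l + tau))%:R.
have near0 i : 0 <= near i by apply: sumr_ge0 => l _; exact: ler0n.
pose dLa i := La (t i + h + h) - La (t i).
have dLa0 i : 0 <= dLa i by rewrite subr_ge0; apply: ndLa; lra.
pose E i := expR 1 + expR (3 * pi * L) * near i.
have E0 i : 0 <= E i by rewrite addr_ge0// ?mulr_ge0// expR_ge0.
pose W i := 32 * m ^+ 2 * dLa i * E i.
have W0 i : 0 <= W i.
  by rewrite mulr_ge0// mulr_ge0// mulr_ge0// exprn_ge0// ltW.
pose C1 := 144 * m * M.
pose V z : R[i] := C1%:C + poles K h t W z.
have ReV x y : complex.Re (V (x +i* y)) =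
    C1 + \sum_(i < K) W i * ((y + h) / ((x - t i) ^+ 2 + (y + h) ^+ 2)).
  by rewrite /V ReD Re_poles.
have term0 x y i : 0 <= y -> 0 <= (y + h) / ((x - t i) ^+ 2 + (y + h) ^+ 2).
  by move=> y0; rewrite divr_ge0 ?addr_ge0 ?sqr_ge0// ltW.
have ReV_ge x y : 0 <= y -> C1 <= complex.Re (V (x +i* y)).
  move=> y0; rewrite ReV lerDl; apply: sumr_ge0 => i _.
  by rewrite mulr_ge0// term0.
pose D z := (g (z + h%:C) - g z) / h%:C.
pose N := 4 * m.
pose Y z := D z * ((z - N%:C) * (z + N%:C)) * cexp (s z).
have ds z : 0 <= complex.Im z -> derivable s z 1.
  move=> z0; apply: cderivableM; first exact: cderivable_cst.
  apply: cderivableD; first exact: poles_derivable.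
  apply: cderivableM; first exact: cderivable_cst.
  apply: cderivableB; last exact: cderivable_cst.
  by apply: cderivableM; [exact: cderivable_cst|exact: cderivable_id].
have dq z : derivable (fun w => (w - N%:C) * (w + N%:C)) z 1.
  apply: cderivableM.
    by apply: cderivableB; [exact: cderivable_id|exact: cderivable_cst].
  by apply: cderivableD; [exact: cderivable_id|exact: cderivable_cst].
have dV z : 0 <= complex.Im z -> derivable V z 1.
  move=> z0; apply: cderivableD; first exact: cderivable_cst.
  exact: poles_derivable.
have dY z : 0 < complex.Im z -> derivable Y z 1.
  move=> z0; apply: cderivableM; last first.
    by apply: derivable_cexp_comp; apply: ds; exact: ltW.
  apply: cderivableM; last exact: dq.
  apply: cderivableM; last exact: cderivable_cst.
  apply: cderivableB; last exact: dg.
  by apply: cderivable_translate; apply: dg; rewrite ImD /= addr0.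
have Qsub : rectangle (- N) N 0 N `<=` [set w | 0 <= complex.Im w].
  by move=> w [_ /andP[]].
have cg' := continuous_subspaceW Qsub cg.
have cY : {within rectangle (- N) N 0 N, continuous Y}.
  apply: within_continuousM; last first.
    by apply: derivable_within_cont => z /Qsub z0; apply: derivable_cexp_comp; exact: ds.
  apply: within_continuousM; last by apply: derivable_within_cont => z _; exact: dq.
  apply: within_continuousM; last first.
    by apply: derivable_within_cont => z _; exact: cderivable_cst.
  apply: within_continuousB; last exact: cg'.
  apply: within_continuous_translate cg => z /Qsub /=.
  by rewrite ImD /= addr0.
have cV : {within rectangle (- N) N 0 N, continuous V}.
  by apply: derivable_within_cont => z /Qsub; exact: dV.
have M0 : 0 <= M.
  apply: le_trans (bg 0 _ _); rewrite ?normc_ge0//= ?normr0; last by rewrite lexx; lra.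
  by lra.
have C10 : 0 <= C1 by rewrite mulr_ge0// mulr_ge0// ltW.
have Yle z : complex.Re (s z) <= 0 -> normc (Y z) <=
    normc (D z) * (normc (z - N%:C) * normc (z + N%:C)).
  move=> s0; rewrite /Y !normcM normc_cexp -[leRHS]mulr1 ler_wpM2l//.
    by rewrite !mulr_ge0// normc_ge0.
  by rewrite -expR0 ler_expR.
(* off the real side the exponential is at most 1; on the vertical sides the
   factor z - N or z + N has modulus y and absorbs the 1 / y of D *)
have sides x y : `|x| <= N -> 0 <= y -> y <= N -> `|x| = N \/ y = N ->
    normc (Y (x +i* y)) <= complex.Re (V (x +i* y)).
  move=> xN y0 yN bd; apply: le_trans (ReV_ge x y y0).
  have /Yle : complex.Re (s (x +i* y)) <= 0.
    apply: Res_le0 => // i /chi_m /andP[ti1 ti2].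
    have m2 := sqr_ge0 m.
    case: bd => [xe|ye].
      apply: (@le_trans _ _ ((x - t i) ^+ 2)); last by rewrite lerDl sqr_ge0.
      have -> : 9 * m ^+ 2 = (3 * m) ^+ 2 by ring.
      rewrite -(real_normK (num_real (x - t i))) ler_sqr ?nnegrE ?mulr_ge0 ?(ltW m0)//.
      apply: (@le_trans _ _ (`|x| - `|t i|)); last exact: lerB_dist.
      have : `|t i| <= m by rewrite ler_norml ti1.
      by rewrite xe /N; lra.
    apply: (@le_trans _ _ ((y + h) ^+ 2)); last by rewrite lerDr sqr_ge0.
    have -> : 9 * m ^+ 2 = (3 * m) ^+ 2 by ring.
    by clear -ye y0 h0 m0; rewrite ye ler_sqr ?nnegrE /N; lra.
  move=> h2; apply: le_trans h2 _.
  have n1 : normc ((x +i* y) - N%:C) <= `|x - N| + y.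
    by apply: le_trans (normc_le_ReIm _) _; rewrite /= subr0 (ger0_norm y0).
  have n2 : normc ((x +i* y) + N%:C) <= `|x + N| + y.
    by apply: le_trans (normc_le_ReIm _) _; rewrite /= addr0 (ger0_norm y0).
  have xN' := xN; rewrite ler_norml in xN'; have /andP[x1 x2] := xN'.
  have u1 : `|x - N| = N - x by rewrite ler0_norm ?opprB// subr_le0.
  have u2 : `|x + N| = x + N by rewrite ger0_norm//; lra.
  rewrite u1 in n1; rewrite u2 in n2.
  have D0 := normc_ge0 (D (x +i* y)).
  have [y00|yp] := eqVneq y 0.
    have Nn0 : N != 0 by rewrite gt_eqF// mulr_gt0.
    have xe : `|x| = N by case: bd => // ye; move: Nn0; rewrite -ye y00 eqxx.
    have [z1|z1] : normc ((x +i* y) - N%:C) = 0 \/ normc ((x +i* y) + N%:C) = 0.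
      have [xp|xn] := leP 0 x.
        left; apply/eqP; rewrite eq_le normc_ge0 andbT; apply: le_trans n1 _.
        by rewrite ger0_norm// in xe; lra.
      right; apply/eqP; rewrite eq_le normc_ge0 andbT; apply: le_trans n2 _.
      by rewrite ltr0_norm// in xe; lra.
    - by rewrite z1 mul0r mulr0.
    - by rewrite z1 !mulr0.
  have y0' : 0 < y by rewrite lt_neqAle eq_sym yp.
  have bD : normc (D (x +i* y)) <= 4 * M / y.
    by apply: (@difference_quotient_bound g m M) => //=; rewrite y0'.
  have bq : normc ((x +i* y) - N%:C) * normc ((x +i* y) + N%:C) <= y * (36 * m).
    apply: (@le_trans _ _ ((N - x + y) * (x + N + y))); first by rewrite ler_pM ?normc_ge0.
    case: bd => [xe|->].
      have [xp|xn] := leP 0 x.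
        rewrite ger0_norm// in xe; rewrite xe subrr add0r ler_pM2l// /N.
        by rewrite /N in yN; lra.
      rewrite ltr0_norm// in xe; have -> : x = - N by lra.
      by rewrite addNr add0r mulrC ler_pM2l// /N; rewrite /N in yN; lra.
    apply: (@le_trans _ _ ((12 * m) * (12 * m))).
      by rewrite /N in x1 x2 *; clear -x1 x2 m1 u1 u2; rewrite ler_pM//; lra.
    by rewrite /N; have -> : 12 * m * (12 * m) = 4 * m * (36 * m) by ring.
  apply: le_trans (ler_pM D0 _ bD bq) _; first by rewrite mulr_ge0// normc_ge0.
  by rewrite /C1; have -> : 4 * M / y * (y * (36 * m)) = 144 * m * M by field.
have kh : K%:R * h != 0 by rewrite Kh gt_eqF// mulr_gt0.
have Kpos : (0 < K)%N by rewrite lt0n; apply: contraNneq kh => ->; rewrite mul0r.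
have tau0 : 0 < tau by lra.
have B1 x : expR (L * \sum_(j < K) chi j * h * (h / ((x - t j) ^+ 2 + h ^+ 2)))
    <= expR (3 * pi * L).
  rewrite ler_expR mulrC ler_wpM2r//.
  apply: le_trans (discrete_poisson_bound K (- (4 * m)) x h0).
  apply: ler_sum => j _; rewrite -/(t j) -mulrA ler_piMl//.
  by rewrite mulr_ge0 ?(ltW h0)// divr_ge0 ?(ltW h0)// addr_ge0 ?sqr_ge0.
have B2 i x : near i = 0 -> t i <= x <= t i + h ->
    expR (L * \sum_(j < K) chi j * h * (h / ((x - t j) ^+ 2 + h ^+ 2))) <= expR 1.
  move=> ni /andP[x1 x2]; rewrite ler_expR.
  have far l : t i + h <= al l - tau \/ be l + tau <= t i.
    have : (((al l - tau < t i + h) && (t i < be l + tau))%:R : R) = 0.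
      apply/eqP; move/eqP: ni; rewrite psumr_eq0 => [/allP/(_ l)|j _]; last exact: ler0n.
      by rewrite mem_index_enum => /(_ isT).
    case: (ltP (al l - tau) (t i + h)) => [_|]; last by left.
    case: (ltP (t i) (be l + tau)) => [_ /= /eqP|]; last by right.
    by rewrite oner_eq0.
  apply: (@le_trans _ _ (L * (K%:R * h * h / tau ^+ 2))).
    rewrite ler_wpM2l//; apply: poles_far => // j; first by rewrite chi0 chi1.
    case: (chiE j) => [|[l /andP[l1 l2]]]; [by left|right].
    clear -far l1 l2 x1 x2; case: (far l) => f.
      by rewrite distrC; apply: le_trans (ler_norm _); lra.
    by apply: le_trans (ler_norm _); lra.
  by rewrite Kh mulrA ler_pdivrMr ?exprn_gt0// mul1r.
(* on the real side |D| is at most the variation of La over two cells divided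
   by h *)
have bottom x : - N <= x -> x <= N ->
    normc (Y (x +i* 0)) <= complex.Re (V (x +i* 0)).
  move=> x1 x2.
  have [i iK /andP[i1 i2]] : exists2 i, (i < K)%N &
      - (4 * m) + i%:R * h <= x <= - (4 * m) + i%:R * h + h.
    by apply: grid_locate => //; rewrite -/(t K) tK x1.
  rewrite -/(t i) in i1 i2.
  have ti1 : - (4 * m) <= t i by rewrite lerDl mulr_ge0 ?(ltW h0).
  have es : normc (cexp (s (x +i* 0))) <= E i.
    rewrite normc_cexp Res add0r.
    apply: (@le_trans _ _ (expR (L * \sum_(j < K) chi j * h *
       (h / ((x - t j) ^+ 2 + h ^+ 2))))).
      by rewrite ler_expR ler_wpM2l// gerBl mulr_ge0// ltW.
    have [n0|nn] := eqVneq (near i) 0.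
      apply: le_trans (B2 i x n0 _) _; first by rewrite i1.
      by rewrite /E lerDl mulr_ge0// expR_ge0.
    apply: le_trans (B1 x) _.
    apply: (@le_trans _ _ (expR (3 * pi * L) * near i)); last first.
      by rewrite /E lerDr expR_ge0.
    rewrite -[leLHS]mulr1 ler_wpM2l ?expR_ge0//.
    move: nn; rewrite /near -natr_sum pnatr_eq0 -lt0n => nn.
    by rewrite (_ : 1 = 1%:R :> R) // ler_nat.
  have bD : normc (D (x +i* 0)) <= dLa i / h.
    rewrite /D normcM normcV normc_real (gtr0_norm h0) ler_pM2r ?invr_gt0//.
    have -> : (x +i* 0) + h%:C = (x + h)%:C.
      by apply/eqP; rewrite eq_complex /= addr0 !eqxx.
    rewrite /N in x1 x2.
    have [b1 b2 b3] : [/\ - (8 * m) <= x, x <= x + h & x + h <= 8 * m].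
      by clear -x1 x2 m1 h0 h1; split; lra.
    apply: le_trans (gLa x (x + h) b1 b2 b3) _.
    by rewrite /dLa lerB// ndLa//; clear -i1 i2; lra.
  have bq : normc (((x +i* 0) - N%:C) * ((x +i* 0) + N%:C)) <= 16 * m ^+ 2.
    have -> : ((x +i* 0) - N%:C) * ((x +i* 0) + N%:C) = (x ^+ 2 - N ^+ 2)%:C.
      by apply/eqP; rewrite eq_complex /=; apply/andP; split; apply/eqP; ring.
    rewrite normc_real ler0_norm ?opprB.
      by rewrite /N exprMn; have := sqr_ge0 x; lra.
    rewrite subr_le0 -(real_normK (num_real x)) ler_sqr ?nnegrE ?ler_norml ?x1//.
    by rewrite /N; clear -m0; lra.
  rewrite /Y normcM normcM.
  apply: le_trans (ler_pM _ _ (ler_pM _ _ bD bq) es) _; rewrite ?normc_ge0//.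
    by rewrite mulr_ge0// normc_ge0.
  rewrite ReV add0r.
  apply: (@le_trans _ _ (W i * (h / ((x - t i) ^+ 2 + h ^+ 2)))).
    have -> : dLa i / h * (16 * m ^+ 2) * E i = W i * (2 * h)^-1.
      by rewrite /W; field; rewrite gt_eqF.
    rewrite ler_wpM2l//.
    have -> : (2 * h)^-1 = h / (h ^+ 2 + h ^+ 2).
      have -> : h ^+ 2 + h ^+ 2 = 2 * h * h by ring.
      by field; rewrite gt_eqF.
    have hh : 0 < h ^+ 2 by rewrite exprn_gt0.
    have hh2 : 0 < h ^+ 2 + h ^+ 2 by rewrite addr_gt0.
    have hx : 0 < (x - t i) ^+ 2 + h ^+ 2 by rewrite ltr_wpDl// sqr_ge0.
    rewrite ler_pM2l// lef_pV2 ?posrE//.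
    by clear -i1 i2 h0; rewrite lerD2r ler_sqr ?nnegrE ?(ltW h0)//; lra.
  rewrite (bigD1 (Ordinal iK)) //= addrCA lerDl addr_ge0//.
  apply: sumr_ge0 => j _; rewrite mulr_ge0//.
  by have := term0 x 0 j (lexx 0); rewrite add0r.
have NN : - N <= 0 <= N by clear -m0; rewrite /N; apply/andP; split; lra.
have main : normc (Y (0 +i* m)) <= complex.Re (V (0 +i* m)).
  apply: (@modulus_majorant R Y V (- N) N 0 N).
  - by move=> z [_ /andP[z0 _]]; exact: dY.
  - by move=> z [_ /andP[z0 _]]; apply: dV; exact: ltW.
  - exact: cY.
  - exact: cV.
  - move=> [x y] [[/= /andP[x1 x2] /andP[y1 y2]] bd].
    have xN : `|x| <= N by rewrite ler_norml x1.
    case: bd => eq.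
    + by apply: sides => //; left; rewrite eq normrN ger0_norm//; case/andP: NN.
    + by apply: sides => //; left; rewrite eq ger0_norm//; case/andP: NN.
    + by rewrite eq; exact: bottom.
    + by apply: sides => //; right.
  - by clear -m0; split => //=; rewrite /N; apply/andP; split; lra.
move: main; rewrite /Y normcM normcM normc_cexp -/(D (0 +i* m)).
have -> : normc (((0 +i* m) - N%:C) * ((0 +i* m) + N%:C)) = 17 * m ^+ 2.
  have -> : ((0 +i* m) - N%:C) * ((0 +i* m) + N%:C) = (- (17 * m ^+ 2))%:C.
    by apply/eqP; rewrite eq_complex /= /N; apply/andP; split; apply/eqP; ring.
  by rewrite normc_real normrN ger0_norm// mulr_ge0// sqr_ge0.
have mm0 : 0 < m ^+ 2 by rewrite exprn_gt0.
(* the poles are at squared distance at most 5 m^2 from i m, and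
   1 / 5 - 1 / 9 = 4 / 45 *)
have slow : L * ((\sum_(l < n) (be l - al l) - n%:R * h) * (4 / (45 * m))) <=
    complex.Re (s (0 +i* m)).
  rewrite Res ler_wpM2l//.
  apply: (@le_trans _ _ (mu' * (4 / (45 * m)))).
    rewrite ler_wpM2r ?divr_ge0// ?mulr_ge0 ?(ltW m0)//.
    have -> : mu' = \sum_(l < n) \sum_(i < K) ((al l < t i) && (t i < be l))%:R * h.
      by rewrite exchange_big /=; apply: eq_bigr => i _; rewrite mulr_suml.
    rewrite mulr_natl -[n in h *+ n]card_ord -sumr_const -sumrB.
    apply: ler_sum => l _; apply: grid_count => //; have [a1 a2 a3] := albe l.
      lra.
    by rewrite -/(t K) tK; lra.
  rewrite /kap /mu' !mulr_suml -sumrB; apply: ler_sum => i _.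
  case: (chiE i) => [->|/chi_m /andP[t1 t2]]; first by rewrite !mul0r subr0.
  rewrite -!mulrA -mulrBr ler_wpM2l// -mulrBr ler_pM2l//.
  rewrite (mulrC (9 * m ^+ 2)^-1) -mulrBr sub0r sqrrN.
  apply: (@le_trans _ _ (m * (4 / (45 * m ^+ 2)))).
    by rewrite le_eqVlt; apply/orP; left; apply/eqP; field; rewrite gt_eqF.
  rewrite ler_pM ?(ltW m0)//; [by rewrite divr_ge0// mulr_ge0// ltW
    |by clear -h0; lra|].
  have t2m : t i ^+ 2 <= m ^+ 2.
    rewrite -(real_normK (num_real (t i))) ler_sqr ?nnegrE ?(ltW m0)//.
    by rewrite ler_norml t1.
  have mh2 : (m + h) ^+ 2 <= 4 * m ^+ 2.
    have -> : 4 * m ^+ 2 = (2 * m) ^+ 2 by ring.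
    by clear -h0 h1 m1; rewrite ler_sqr ?nnegrE; lra.
  have den : 0 < t i ^+ 2 + (m + h) ^+ 2.
    by clear -m0 h0; rewrite ltr_wpDl ?sqr_ge0// exprn_gt0//; lra.
  have : (5 * m ^+ 2)^-1 <= (t i ^+ 2 + (m + h) ^+ 2)^-1.
    by clear -m0 mm0 den t2m mh2; rewrite lef_pV2 ?posrE ?mulr_gt0//; lra.
  have -> : 4 / (45 * m ^+ 2) = (5 * m ^+ 2)^-1 - (9 * m ^+ 2)^-1.
    by field; rewrite gt_eqF.
  by lra.
have Vup : complex.Re (V (0 +i* m)) <= C1 + 32 * m *
    (2 * expR 1 * (La (4 * m + 1) - La (- (4 * m))) +
     2 * expR (3 * pi * L) *
       \sum_(l < n) (La (be l + 2 * tau) - La (al l - 2 * tau))).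
  rewrite ReV lerD2l.
  apply: (@le_trans _ _ (\sum_(i < K) 32 * m * (dLa i * E i))).
    apply: ler_sum => i _.
    have -> : 32 * m * (dLa i * E i) = W i / m by rewrite /W; field; rewrite gt_eqF.
    rewrite ler_wpM2l//.
    have mh : 0 < m + h by clear -m0 h0; lra.
    apply: (@le_trans _ _ ((m + h) / (m + h) ^+ 2)).
      rewrite ler_pM2l// lef_pV2 ?posrE ?exprn_gt0//.
        by rewrite lerDr sqr_ge0.
      by rewrite ltr_wpDl ?sqr_ge0// exprn_gt0.
    rewrite expr2 invfM mulrA divff ?gt_eqF// mul1r lef_pV2 ?posrE//.
    by clear -h0; lra.
  rewrite -mulr_sumr ler_pM2l ?mulr_gt0//.
  have albe' l : al l <= be l by have [] := albe l.
  have := weighted_grid_variation K (- (4 * m)) h0 htau (expR_gt0 1)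
    (expR_gt0 (3 * pi * L)) ndLa albe'.
  move/le_trans; apply; rewrite lerD2r ler_pM2l ?mulr_gt0 ?expR_gt0//.
  by rewrite lerB// ndLa// Kh; clear -h1; lra.
move=> main; apply: le_trans (le_trans main Vup).
rewrite ler_wpM2l ?ler_expR//.
by rewrite mulr_ge0 ?normc_ge0// mulr_ge0 ?(ltW mm0).
Qed.

End LavrentievEstimate.

(** * Small variation forces small length *)

Section SmallVariationSmallLength.
Variable R : realType.
Local Open Scope classical_set_scope.
Local Open Scope complex_scope.
Implicit Types (g : R[i] -> R[i]) (La : R -> R) (m M c d e x t : R).
Local Notation normc := ComplexField.Normc.normc.

Lemma finite_min_gt0 n (F : 'I_n -> R) : (forall l, 0 < F l) ->
  exists2 d, 0 < d & forall l, d <= F l.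
Proof.
elim: n F => [|n IH] F F0; first by exists 1 => // -[].
have [d d0 dF] := IH (fun l => F (lift ord0 l)) (fun l => F0 _).
exists (Num.min d (F ord0)); first by rewrite lt_min d0 F0.
move=> l; rewrite ge_min; case: (unliftP ord0 l) => [j|] ->.
  by rewrite dF.
by rewrite lexx orbT.
Qed.

Lemma enlarged_variation La n (al be : 'I_n -> R) e : continuous La ->
  \sum_(l < n) (La (be l) - La (al l)) < e ->
  exists2 d, 0 < d & forall t, 0 <= t -> t < d ->
    \sum_(l < n) (La (be l + t) - La (al l - t)) < e.
Proof.
move=> cLa small; pose k := (e - \sum_(l < n) (La (be l) - La (al l))) / (2 * n.+1%:R).
have k0 : 0 < k by rewrite divr_gt0 ?mulr_gt0 ?subr_gt0.
have near x : {d : R | 0 < d & forall t, `|t - x| < d -> `|La t - La x| < k}.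
  apply: cid2; move: (cLa x) => /cvgrPdist_lt /(_ _ k0) /nbhs_ballP[d /= d0 Hd].
  by exists d => // t tx; rewrite distrC; apply: Hd; rewrite /ball/= distrC.
pose dd x := s2val (near x).
have [d1 d10 H1] := finite_min_gt0 (fun l => s2valP (near (be l))).
have [d2 d20 H2] := finite_min_gt0 (fun l => s2valP (near (al l))).
exists (Num.min d1 d2); first by rewrite lt_min d10.
move=> t t0; rewrite lt_min => /andP[t1 t2].
have b l : La (be l + t) - La (al l - t) <= La (be l) - La (al l) + 2 * k.
  have := s2valP' (near (be l)) (be l + t).
  rewrite addrC addKr ger0_norm// => /(_ (lt_le_trans t1 (H1 l))).
  have := s2valP' (near (al l)) (al l - t).
  rewrite addrC addKr normrN ger0_norm// => /(_ (lt_le_trans t2 (H2 l))).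
  rewrite !ltr_norml => /andP[u1 u2] /andP[u3 u4]; lra.
apply: le_lt_trans (ler_sum _ (fun l _ => b l)) _.
rewrite big_split /= sumr_const card_ord -[_ *+ n]mulr_natl.
rewrite -ltrBrDl /k.
set S := e - _.
have S0 : 0 < S by rewrite subr_gt0.
have n1 : n.+1%:R != 0 :> R by rewrite pnatr_eq0.
have -> : n%:R * (2 * (S / (2 * n.+1%:R))) = S * (n%:R / n.+1%:R).
  by move: n1; set q := n.+1%:R; move: q => q q0; field.
by rewrite gtr_pMr// ltr_pdivrMr// mul1r ltr_nat.
Qed.

(** The exponent [L] in [lavrentiev_estimate] is chosen first, so large that
    intervals of total length [e] would violate the estimate; [eta] is then
    small enough to compensate the factor [expR (3 * pi * L)].  The collar [tau]
    and the grid depend on the intervals, which is harmless as the constants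
    depend on neither. *)
Lemma small_variation_small_length g La m M c d0 e :
  1 <= m -> 0 < c -> 0 < d0 -> 0 < e ->
  (forall w, 0 < complex.Im w -> derivable g w 1) ->
  {within [set w | 0 <= complex.Im w], continuous g} ->
  (forall w, `|complex.Re w| <= 8 * m -> 0 <= complex.Im w <= 8 * m ->
     normc (g w) <= M) ->
  {homo La : x y / x <= y} -> continuous La ->
  (forall t t', - (8 * m) <= t -> t <= t' -> t' <= 8 * m ->
     normc (g t'%:C - g t%:C) <= La t' - La t) ->
  (forall h, 0 < h -> h < d0 ->
     c <= normc ((g (0 +i* m + h%:C) - g (0 +i* m)) / h%:C)) ->
  exists2 eta, 0 < eta & forall n (al be : 'I_n -> R),
    (forall l, [/\ - m <= al l, al l <= be l & be l <= m]) ->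
    (forall x, \sum_(l < n) ((al l < x) && (x < be l))%:R <= 1 :> R) ->
    \sum_(l < n) (La (be l) - La (al l)) < eta ->
    \sum_(l < n) (be l - al l) < e.
Proof.
move=> m1 c0 d00 e0 dg cg bg ndLa cLa gLa lowD.
have m0 : 0 < m by lra.
have M0 : 0 <= M.
  apply: le_trans (bg 0 _ _); rewrite ?normc_ge0//= ?normr0; last by rewrite lexx; lra.
  by lra.
(* B0 bounds the right-hand side of the estimate when the variation over the
   enlarged intervals is at most eta; by the choice of L and by
   1 + x <= exp x, intervals of total length e or more would make the left-hand
   side at least A + B0 *)
pose B0 := 144 * m * M + 32 * m *
  (2 * expR 1 * (La (4 * m + 1) - La (- (4 * m))) + 2).
have dLa0 : 0 <= La (4 * m + 1) - La (- (4 * m)).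
  by rewrite subr_ge0 ndLa//; lra.
have B00 : 0 <= B0.
  rewrite addr_ge0// mulr_ge0// ?mulr_ge0 ?(ltW m0)//.
  by rewrite addr_ge0// mulr_ge0// mulr_ge0// expR_ge0.
pose A := c * (17 * m ^+ 2).
have A0 : 0 < A by rewrite mulr_gt0// mulr_gt0// exprn_gt0.
pose ka := e / 2 * (4 / (45 * m)).
have ka0 : 0 < ka by rewrite mulr_gt0 ?divr_gt0// mulr_gt0.
pose L := B0 / (A * ka).
have L0 : 0 <= L by rewrite divr_ge0// mulr_ge0 ?ltW.
pose eta := expR (- (3 * pi * L)).
have eta0 : 0 < eta by exact: expR_gt0.
exists eta => // n al be albe disj small.
rewrite ltNge; apply/negP => le.
have [dt dt0 Hdt] := enlarged_variation cLa small.
pose tau := dt / 4.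
have tau0 : 0 < tau by rewrite divr_gt0.
have var : \sum_(l < n) (La (be l + 2 * tau) - La (al l - 2 * tau)) < eta.
  by apply: Hdt; rewrite /tau; lra.
have Lm : 0 < L * (8 * m) + 1 by rewrite ltr_wpDl// mulr_ge0// mulr_ge0// ltW.
pose del := Num.min (Num.min (Num.min 1 (tau / 2)) (Num.min d0 (e / (2 * n.+1%:R))))
  (tau ^+ 2 / (L * (8 * m) + 1)).
have del0 : 0 < del.
  by rewrite !lt_min ltr01 d00 !divr_gt0// ?mulr_gt0// exprn_gt0.
pose K := Num.bound (8 * m / del).
have Kb : 8 * m / del < K%:R.
  by apply: archi_boundP; rewrite divr_ge0 ?(ltW del0)// mulr_ge0// ltW.
have K0 : 0 < K%:R :> R.
  by apply: le_lt_trans Kb; rewrite divr_ge0 ?(ltW del0)// mulr_ge0// ltW.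
pose h := 8 * m / K%:R.
have h0 : 0 < h by rewrite divr_gt0// mulr_gt0.
have hdel : h < del.
  by rewrite /h ltr_pdivrMr// (mulrC del) -ltr_pdivrMr.
move: (hdel); rewrite !lt_min => /andP[/andP[/andP[h1 htau] /andP[hd0 he]] hL].
have Kh : K%:R * h = 8 * m by rewrite /h mulrC divfK// gt_eqF.
have est := @lavrentiev_estimate R g La m M h tau L K n al be m1 h0 Kh (ltW h1)
  ltac:(lra) L0 _ dg cg bg ndLa gLa albe disj.
have {}est := est _.
have hL' : L * (8 * m * h) <= tau ^+ 2.
  have := hL; rewrite ltr_pdivlMr// => /ltW; apply: le_trans.
  have -> : h * (L * (8 * m) + 1) = L * (8 * m * h) + h by ring.
  by rewrite lerDl ltW.
move: (est hL'); apply/negP; rewrite -ltNge.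
have nh : n%:R * h <= e / 2.
  apply: (@le_trans _ _ (n%:R * (e / (2 * n.+1%:R)))).
    by rewrite ler_wpM2l// ltW.
  have -> : n%:R * (e / (2 * n.+1%:R)) = e / 2 * (n%:R / n.+1%:R).
    have : n.+1%:R != 0 :> R by rewrite pnatr_eq0.
    by set q := n.+1%:R; move: q => q q0; field.
  by rewrite ger_pMr ?divr_gt0// ler_pdivrMr// mul1r ler_nat.
have m45 : 0 < 4 / (45 * m) by rewrite divr_gt0// mulr_gt0.
apply: (@le_lt_trans _ _ B0).
  rewrite lerD2l ler_pM2l ?mulr_gt0// lerD2l -[leRHS]mulr1 -mulrA ler_pM2l//.
  apply: (@le_trans _ _ (expR (3 * pi * L) * eta)).
    by rewrite ler_pM2l ?expR_gt0// ltW.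
  by rewrite /eta -expRD subrr expR0.
apply: (@lt_le_trans _ _ (A * expR (L * ka))).
  apply: (@lt_le_trans _ _ (A * (1 + L * ka))); last first.
    by rewrite ler_pM2l// expR_ge1Dx.
  have -> : A * (1 + L * ka) = A + B0 by rewrite /L; field; rewrite !gt_eqF.
  by rewrite ltrDr.
rewrite ler_pM ?expR_ge0 ?(ltW A0)//.
  by rewrite ler_wpM2r ?lowD// mulr_ge0// sqr_ge0.
rewrite ler_expR ler_wpM2l// ler_wpM2r ?(ltW m45)//.
clear -nh le; lra.
Qed.

End SmallVariationSmallLength.

(** * Families of intervals and total variation *)

Section VariationOfAbsolutelyContinuous.
Variable R : realType.
Local Open Scope classical_set_scope.
Implicit Types (f V : R -> R) (a b x y e d : R) (s r : seq (R * R)) (p q : R * R).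

(** In terms of end points, so that a degenerate interval is disjoint from every
    interval, as are the corresponding open intervals. *)
Definition interior_disjoint p q := Num.min p.2 q.2 <= Num.max p.1 q.1.

Definition interval_family a b s :=
  all (fun p => [&& a <= p.1, p.1 <= p.2 & p.2 <= b]) s &&
  pairwise interior_disjoint s.

Definition family_length s := \sum_(p <- s) (p.2 - p.1).
Definition family_variation f s := \sum_(p <- s) `|f p.2 - f p.1|.

Definition pieces x (l : seq R) := zip (x :: l) l.

Lemma interior_disjoint_sub p q p' : interior_disjoint p q ->
  p.1 <= p'.1 -> p'.2 <= p.2 -> interior_disjoint p' q.
Proof.
rewrite /interior_disjoint => h h1 h2; apply: le_trans (le_trans h _).
  by rewrite le_min !ge_min h2 lexx orbT.
by rewrite ge_max !le_max h1 lexx orbT.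
Qed.

Lemma interior_disjointC p q : interior_disjoint p q = interior_disjoint q p.
Proof. by rewrite /interior_disjoint minC maxC. Qed.

(** Lists of intervals, unlike families indexed by ordinals, are easily refined:
    an interval is replaced by concatenating its pieces. *)
Lemma abs_continuous_on_seq f a b : abs_continuous_on a b f ->
  forall e, 0 < e -> exists2 d, 0 < d & forall s, interval_family a b s ->
    family_length s < d -> family_variation f s < e.
Proof.
move=> H e e0; have [d d0 Hd] := H e e0; exists d => // s /andP[/allP sa sp] sd.
pose x (i : 'I_(size s)) := (nth (0, 0) s i).1.
pose y (i : 'I_(size s)) := (nth (0, 0) s i).2.
have := Hd (size s) x y.
rewrite /family_variation (big_nth (0, 0)) big_mkord; apply.
- by move=> i; have /and3P[] := sa _ (mem_nth (0, 0) (ltn_ord i)).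
- move=> i j _ _ [z [/=]]; rewrite !in_itv/= => /andP[i1 i2] /andP[j1 j2].
  have dij (u v : 'I_(size s)) : (u < v)%N -> x u < z -> z < y u ->
      x v < z -> z < y v -> False.
    move=> uv xu yu xv yv.
    have := (pairwiseP (0, 0) sp) u v (ltn_ord u) (ltn_ord v) uv.
    rewrite /interior_disjoint leNgt => /negP; apply.
    by rewrite gt_max !lt_min (lt_trans xu yu) (lt_trans xu yv)
      (lt_trans xv yu) (lt_trans xv yv).
  apply: val_inj; case: (ltngtP (val i) (val j)) => // ij; exfalso.
    exact: (dij i j).
  exact: (dij j i).
- by move: sd; rewrite /family_length (big_nth (0, 0)) big_mkord.
Qed.

Lemma pieces_family x y l : itv_partition x y l -> interval_family x y (pieces x l).
Proof.
elim: l x => [|z l IH] x //; rewrite /itv_partition /= => -[/andP[xz pl] lst].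
have /andP[al pw] := IH z (conj pl lst).
have zy : z <= y.
  exact: itv_partition_le (conj pl lst).
rewrite /interval_family /= lexx (ltW xz) zy /=; apply/and3P; split.
- apply/allP => p pin; have /and3P[h1 h2 h3] := allP al p pin.
  by rewrite (le_trans (ltW xz) h1) h2 h3.
- apply/allP => p pin; have /and3P[h1 h2 h3] := allP al p pin.
  by rewrite /interior_disjoint /= ge_min le_max h1 orbT.
- exact: pw.
Qed.

Lemma pieces_length x y l : itv_partition x y l ->
  family_length (pieces x l) = y - x.
Proof.
rewrite /family_length; elim: l x => [|z l IH] x.
  by rewrite /itv_partition /= => -[_ /eqP ->]; rewrite big_nil subrr.
move=> /itv_partition_cons /IH; rewrite /pieces /= big_cons /= => ->; ring.
Qed.

Lemma pieces_variation f x y l : itv_partition x y l ->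
  variation x y f l = family_variation f (pieces x l).
Proof.
move=> h; rewrite variation_zip//; rewrite /family_variation /pieces.
elim: l x {h} => [|z l IH] x; first by rewrite !big_nil.
by rewrite /= !big_cons /= IH.
Qed.

(** The intervals of [s] are treated one at a time.  To replace the increment of
    [f] over one of them by its total variation, take the supremum over its
    partitions: for each partition the bound is the induction hypothesis, the
    pieces being moved to the list [r] of intervals that are left as they are. *)
Lemma total_variation_family f a b e d :
  (forall s, interval_family a b s -> family_length s < d ->
     family_variation f s <= e) ->
  forall s r, interval_family a b (s ++ r) -> family_length (s ++ r) < d ->
  (\sum_(p <- s) total_variation p.1 p.2 f + (family_variation f r)%:E <= e%:E)%E.
Proof.
move=> H; elim=> [|p s IH] r; first by rewrite big_nil add0e lee_fin; exact: H.
rewrite /interval_family /= -!andbA => /and5P[p1 p2 p3 al].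
rewrite all_cat pairwise_cat => /andP[dp /and3P[asr ps pr]] len.
have p12 : p.1 <= p.2 by [].
have key l : itv_partition p.1 p.2 l ->
    (\sum_(q <- s) total_variation q.1 q.2 f +
      (variation p.1 p.2 f l + family_variation f r)%:E <= e%:E)%E.
  move=> lp; rewrite (pieces_variation _ lp).
  have -> : family_variation f (pieces p.1 l) + family_variation f r =
      family_variation f (pieces p.1 l ++ r) by rewrite /family_variation big_cat.
  have /andP[pal ppw] := pieces_family lp.
  move: dp => /andP[/allP dps /allP dpr].
  have sub q : q \in pieces p.1 l -> p.1 <= q.1 /\ q.2 <= p.2.
    by move=> /(allP pal) /and3P[].
  apply: IH; last first.
    move: len; rewrite /family_length big_cons !big_cat /= => len.
    have := pieces_length lp; rewrite /family_length => ->.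
    by rewrite addrCA.
  rewrite /interval_family; apply/andP; split.
    move: al; rewrite !all_cat => /andP[-> ->] /=; rewrite andbT.
    apply/allP => q qp; have /and3P[h1 h2 h3] := allP pal q qp.
    by rewrite (le_trans p1 h1) h2 (le_trans h3 p3).
  rewrite !pairwise_cat allrel_catr ps pr asr ppw /= !andbT.
  apply/andP; split; apply/allrelP => u v uin vin.
    have [h1 h2] := sub v vin.
    by rewrite interior_disjointC; apply: interior_disjoint_sub h1 h2; exact: dps.
  by have [h1 h2] := sub u uin; apply: interior_disjoint_sub h1 h2; exact: dpr.
rewrite big_cons.
have TV0 q : (0 <= total_variation q.1 q.2 f)%E \/ q.2 < q.1.
  by have [h|h] := leP q.1 q.2; [left; exact: total_variation_ge0|right].
have S0 : (0 <= \sum_(q <- s) total_variation q.1 q.2 f)%E.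
  rewrite big_seq; apply: sume_ge0 => q qs; apply: total_variation_ge0.
  by move: al; rewrite all_cat => /andP[/allP /(_ q qs) /and3P[]].
have r0 : 0 <= family_variation f r by apply: sumr_ge0.
have Sfin : (\sum_(q <- s) total_variation q.1 q.2 f)%E \is a fin_num.
  rewrite ge0_fin_numE//.
  have [l lp] : exists l, itv_partition p.1 p.2 l.
    move: p12; rewrite le_eqVlt => /orP[/eqP ->|lt].
      by exists [::]; split => //=.
    by exists [:: p.2]; exact: itv_partition1.
  apply: le_lt_trans (ltry e); apply: le_trans (key l lp).
  by rewrite leeDl// lee_fin addr_ge0// variation_ge0.
rewrite -addeA -(fineK Sfin) -EFinD -leeBrDr// -EFinB.
apply: ge_ereal_sup => _ [_ [l lp <-] <-].
by have := key l lp; rewrite -(fineK Sfin) -EFinD !lee_fin; lra.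
Qed.

End VariationOfAbsolutelyContinuous.

(** * A dominating variation function *)

Section DominatingVariation.
Variable R : realType.
Local Open Scope classical_set_scope.
Implicit Types (f V phi psi : R -> R) (a b x y u v e d t : R) (s : seq (R * R)).

Lemma total_variation_finite f a b d : 0 < d ->
  (forall x y, a <= x -> x <= y -> y <= b -> y - x < d ->
     total_variation x y f \is a fin_num) ->
  forall y, a <= y -> y <= b -> total_variation a y f \is a fin_num.
Proof.
move=> d0 H.
have key n : forall y, a <= y -> y <= b -> y <= a + n%:R * (d / 2) ->
    total_variation a y f \is a fin_num.
  elim: n => [|n IH] y ay yb.
    rewrite mul0r addr0 => ya; have -> : y = a by apply/eqP; rewrite eq_le ya ay.
    by rewrite total_variationxx.
  move=> yn; have [ya|ya] := leP y (a + d / 2).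
    by apply: H => //; lra.
  rewrite (@total_variationD _ a y (y - d / 2)); [|lra|lra].
  rewrite fin_numD; apply/andP; split; last by apply: H => //; lra.
  by apply: IH; [lra|lra|move: yn; rewrite -natr1 mulrDl; lra].
move=> y ay yb.
apply: (key (Num.bound ((y - a) / (d / 2)))) => //.
rewrite -lerBlDl -ler_pdivrMr ?divr_gt0//.
by apply/ltW/archi_boundP; rewrite divr_ge0 ?subr_ge0// divr_ge0// ltW.
Qed.

(** [V] is the total variation of [f] from [a], prolonged by constants so as to be
    monotone and continuous on the whole line. *)
Lemma dominating_variation f a b : a <= b -> abs_continuous_on a b f ->
  exists V : R -> R, [/\ {homo V : x y / x <= y}, continuous V,
    (forall x y, a <= x -> x <= y -> y <= b -> `|f y - f x| <= V y - V x) &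
    (forall e, 0 < e -> exists2 d, 0 < d & forall s, interval_family a b s ->
       family_length s < d -> \sum_(p <- s) (V p.2 - V p.1) < e)].
Proof.
move=> ab fac; have ACs := abs_continuous_on_seq fac.
have TVs e : 0 < e -> exists2 d, 0 < d & forall s, interval_family a b s ->
    family_length s < d -> (\sum_(p <- s) total_variation p.1 p.2 f <= e%:E)%E.
  move=> e0; have [d d0 Hd] := ACs e e0; exists d => // s sg sd.
  have := @total_variation_family _ f a b e d _ s [::].
  rewrite cats0 {2}/family_variation big_nil adde0; apply => // s' g' d'.
  exact: ltW (Hd s' g' d').
have single x y : a <= x -> x <= y -> y <= b -> interval_family a b [:: (x, y)].
  by move=> ax xy yb; rewrite /interval_family /= ax xy yb.
have fin x y : a <= x -> x <= y -> y <= b -> total_variation x y f \is a fin_num.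
  move=> ax xy yb.
  have fina z : a <= z -> z <= b -> total_variation a z f \is a fin_num.
    have [d d0 Hd] := TVs 1 ltr01.
    apply: (total_variation_finite d0) => u v au uv vb uvd.
    have := Hd _ (single u v au uv vb); rewrite /family_length !big_seq1 => /(_ uvd) le.
    rewrite ge0_fin_numE ?total_variation_ge0//.
    by apply: le_lt_trans le _; exact: ltry.
  have := fina y (le_trans ax xy) yb.
  by rewrite (total_variationD f ax xy) fin_numD => /andP[].
pose c x := Num.max a (Num.min x b).
have cin x : a <= c x /\ c x <= b.
  by split; rewrite /c ?le_max ?lexx// ge_max ab ge_min lexx orbT.
have cE x : a <= x -> x <= b -> c x = x.
  by move=> ax xb; rewrite /c min_l// max_r.
have ndc : {homo c : x y / x <= y}.
  move=> x y xy; rewrite /c ge_max !le_max lexx /= le_min !ge_min xy lexx.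
  by rewrite !orbT.
pose V x := fine (total_variation a (c x) f).
have VB x y : x <= y -> (V y - V x)%:E = total_variation (c x) (c y) f.
  move=> xy; have [ax xb] := cin x; have [ay yb] := cin y.
  rewrite /V (total_variationD f ax (ndc _ _ xy)) fineD ?fin//; last exact: ndc.
    by rewrite addrC addKr fineK// fin// ndc.
have ndV : {homo V : x y / x <= y}.
  move=> x y xy; rewrite -subr_ge0 -lee_fin VB// total_variation_ge0//.
  exact: ndc.
have VAC e : 0 < e -> exists2 d, 0 < d & forall s, interval_family a b s ->
    family_length s < d -> \sum_(p <- s) (V p.2 - V p.1) < e.
  move=> e0; have [d d0 Hd] := TVs (e / 2) ltac:(by rewrite divr_gt0).
  exists d => // s sg sd; apply: le_lt_trans (_ : _ <= e / 2) _; last by lra.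
  rewrite -lee_fin -sumEFin; apply: le_trans (Hd s sg sd).
  rewrite le_eqVlt; apply/orP; left; apply/eqP.
  rewrite big_seq [RHS]big_seq; apply: eq_bigr => p ps.
  move: sg => /andP[/allP /(_ p ps) /and3P[h1 h2 h3] _].
  by rewrite VB// !cE// ?(le_trans h1 h2)// (le_trans h2 h3).
exists V; split => //; last first.
  move=> x y ax xy yb; have ay := le_trans ax xy; have xb := le_trans xy yb.
  by rewrite -lee_fin VB// !cE//; exact: total_variation_ge.
have close e : 0 < e -> exists2 d, 0 < d & forall x y, x <= y -> y - x < d ->
    V y - V x < e.
  move=> e0; have [d d0 Hd] := VAC e e0; exists d => // x y xy yxd.
  have [ax xb] := cin x; have [ay yb] := cin y.
  have Vc z : V (c z) = V z by rewrite /V (cE (c z)) //; case: (cin z).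
  have := Hd _ (single _ _ ax (ndc _ _ xy) yb).
  rewrite /family_length !big_seq1 /= !Vc; apply.
  apply: le_lt_trans yxd; rewrite /c.
  clear -xy ab; rewrite !maxEle !minEle; do !case: ifPn; rewrite -?ltNge; lra.
move=> x; apply/cvgrPdist_lt => e e0; have [d d0 Hd] := close e e0.
apply/nbhs_ballP; exists d => //= y; rewrite /ball/= => xy.
have [h|/ltW h] := leP x y.
  rewrite distrC ger0_norm ?subr_ge0 ?ndV//; apply: Hd => //.
  by move: xy; rewrite distrC ger0_norm ?subr_ge0.
rewrite ger0_norm ?subr_ge0 ?ndV//; apply: Hd => //.
by move: xy; rewrite ger0_norm ?subr_ge0.
Qed.

End DominatingVariation.

(** * Increasing weldings *)

Section IncreasingWelding.
Variable R : realType.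
Local Open Scope classical_set_scope.
Local Open Scope complex_scope.
Implicit Types (g : R[i] -> R[i]) (f V La phi psi : R -> R).
Implicit Types (a b x y u v e d t m M : R).
Local Notation normc := ComplexField.Normc.normc.

Lemma bounded_on_rectangle g m : 0 <= m ->
  {within [set w | 0 <= complex.Im w], continuous g} ->
  exists M, forall w, `|complex.Re w| <= m -> 0 <= complex.Im w <= m ->
    normc (g w) <= M.
Proof.
move=> m0 /within_continuous_epsP cg.
pose S : set (R * R) := `[- m, m] `*` `[0, m].
have [|||[x0 y0] _ H] := @compact_EVT_max _ R
    (fun z : R * R => normc (g (z.1 +i* z.2))) S.
- by exists (0, 0); split; rewrite /= in_itv/= ?lexx ?m0// oppr_le0 m0.
- apply: compact_setX; exact: segment_compact.
- apply: (@rectangle_pullback_continuous _ (fun z => normc (g z))).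
  move=> z [_ /andP[z0 _]] e e0; have [d d0 Hd] := cg z z0 e e0.
  exists d => // w [_ /andP[w0 _]] wz; apply: le_lt_trans (Hd w w0 wz).
  have n1 := normc_D (g w - g z) (g z); have n2 := normc_D (g z - g w) (g w).
  rewrite !subrK (normcB_sym (g z)) in n1 n2.
  by rewrite ler_norml; apply/andP; split; lra.
exists (normc (g (x0 +i* y0))) => -[x y] /= hx hy.
apply: (H (x, y)); rewrite inE; split; rewrite /= in_itv/= -?ler_norml//.
Qed.

Lemma indicators_le1 n (P : 'I_n -> bool) :
  (forall i j, P i -> P j -> i = j) -> \sum_(l < n) (P l)%:R <= 1 :> R.
Proof.
move=> uniq; have [[i Pi]|none] := pselect (exists i, P i).
  rewrite (bigD1 i)//= big1 ?Pi ?addr0// => j ji.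
  by case: (boolP (P j)) => // Pj; rewrite (uniq j i Pj Pi) eqxx in ji.
rewrite big1// => j _; case: (boolP (P j)) => // Pj.
by case: none; exists j.
Qed.

Lemma increasing_inverse_continuous phi psi :
  {homo phi : x y / x < y} -> cancel psi phi -> continuous psi.
Proof.
move=> inc psiK t; apply/cvgrPdist_lt => e e0.
have lo : phi (psi t - e) < t by rewrite -{2}(psiK t); apply: inc; lra.
have hi : t < phi (psi t + e) by rewrite -{1}(psiK t); apply: inc; lra.
have mono x y : phi x < phi y -> x < y.
  move=> h; rewrite ltNge; apply/negP; rewrite le_eqVlt => /orP[/eqP yx|/inc yx].
    by rewrite yx ltxx in h.
  by move: (lt_trans h yx); rewrite ltxx.
apply/nbhs_ballP; exists (Num.min (t - phi (psi t - e)) (phi (psi t + e) - t)) => /=.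
  by rewrite lt_min !subr_gt0 lo.
move=> t'; rewrite /ball/= lt_min !ltr_norml => /andP[/andP[h1 h2] /andP[h3 h4]].
have l1 : psi t - e < psi t' by apply: mono; rewrite psiK; lra.
have l2 : psi t' < psi t + e by apply: mono; rewrite psiK; lra.
by apply/andP; split; lra.
Qed.

(** With [psi] the inverse of [phi], the function [psi + V \o psi] dominates the
    increments of [g] and varies over the image of an interval by the length of
    the interval plus the variation [V] over it.  Both are small for families of
    small total length, so [small_variation_small_length] applies. *)
Lemma increasing_welding_ac g f phi :
  locally_abs_continuous f ->
  (forall w, 0 < complex.Im w -> derivable g w 1) ->
  {within [set w | 0 <= complex.Im w], continuous g} ->
  (forall y, 0 < y -> exists2 c : R, 0 < c & exists2 d0 : R, 0 < d0 &
     forall h : R, 0 < h -> h < d0 ->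
       c <= normc ((g (0 +i* y + h%:C) - g (0 +i* y)) / h%:C)) ->
  (forall x y, normc (g (phi y)%:C - g (phi x)%:C) <= `|y - x| + `|f y - f x|) ->
  {homo phi : x y / x < y} -> (forall t, exists x, phi x = t) ->
  locally_abs_continuous phi.
Proof.
move=> flac dg cg lowg gphi inc surj a b ab e e0.
have [psi psiK] := choice surj.
have cpsi := increasing_inverse_continuous inc psiK.
have inj x y : phi x = phi y -> x = y.
  by move=> h; have [/inc|/inc|//] := ltgtP x y; rewrite h ltxx.
have phiK x : psi (phi x) = x by apply: inj; rewrite psiK.
have incpsi s t : s <= t -> psi s <= psi t.
  move=> st; rewrite leNgt; apply/negP => /inc; rewrite !psiK => ts.
  by move: (le_lt_trans st ts); rewrite ltxx.
have lephi x y : x <= y -> phi x <= phi y.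
  by rewrite le_eqVlt => /orP[/eqP ->//|/inc/ltW].
pose m : R := 1 + `|phi a| + `|phi b|.
have [m1 ma mb] : [/\ 1 <= m, - m <= phi a & phi b <= m].
  have := normr_ge0 (phi a); have := normr_ge0 (phi b).
  have := ler_norm (phi b); have := ler_norm (- phi a); rewrite normrN /m.
  by split; lra.
clearbody m; have m0 : 0 < m by lra.
(* the part of the graph over [A, B] contains all the boundary values of g
   that enter the estimate *)
pose A := psi (- (8 * m)); pose B := psi (8 * m).
have AB : A <= B by apply: incpsi; lra.
have Aa : A <= a.
  rewrite -[leRHS](phiK a); apply: incpsi; apply: le_trans ma; lra.
have bB : b <= B.
  rewrite -[leLHS](phiK b); apply: incpsi; apply: le_trans mb _; lra.
have [V [ndV cV fV VAC]] := dominating_variation AB (flac A B AB).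
have [M bg] := @bounded_on_rectangle g (8 * m) ltac:(lra) cg.
pose La t := psi t + V (psi t).
have ndLa : {homo La : x y / x <= y}.
  by move=> x y xy; rewrite lerD ?ndV ?incpsi.
have cLa : continuous La.
  move=> t; apply: cvgD; first exact: cpsi.
  by apply: continuous_comp; [exact: cpsi|exact: cV].
have [c c0 [d0 d00 low]] := lowg m m0.
have gLa t t' : - (8 * m) <= t -> t <= t' -> t' <= 8 * m ->
    normc (g t'%:C - g t%:C) <= La t' - La t.
  move=> h1 h2 h3; have := gphi (psi t) (psi t'); rewrite !psiK.
  move/le_trans; apply.
  have := fV (psi t) (psi t') (incpsi _ _ h1) (incpsi _ _ h2) (incpsi _ _ h3).
  by rewrite (ger0_norm (x := psi t' - psi t)) ?subr_ge0 ?incpsi// /La; lra.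
have [eta eta0 Heta] := small_variation_small_length m1 c0 d00 e0 dg cg bg ndLa cLa gLa low.
have [d1 d10 Hd] := VAC (eta / 2) ltac:(by rewrite divr_gt0).
exists (Num.min d1 (eta / 2)); first by rewrite lt_min d10 divr_gt0.
move=> n x y xy tri; rewrite lt_min => /andP[s1 s2].
have sep i j t : x i < t -> t < y i -> x j < t -> t < y j -> i = j.
  move=> i1 i2 j1 j2; apply: (tri i j I I); exists t.
  by split; rewrite /= in_itv/= ?i1 ?i2 ?j1 ?j2.
have -> : \sum_(i < n) `|phi (y i) - phi (x i)| =
    \sum_(i < n) (phi (y i) - phi (x i)).
  apply: eq_bigr => i _; rewrite ger0_norm// subr_ge0 lephi//.
  by have [_ []] := xy i.
apply: (Heta n (fun i => phi (x i)) (fun i => phi (y i))).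
- move=> i; have [h1 [h2 h3]] := xy i; split; last 2 first.
  + exact: lephi.
  + by apply: le_trans mb; exact: lephi.
  + by apply: le_trans ma _; exact: lephi.
- move=> t; apply: indicators_le1 => i j /andP[i1 i2] /andP[j1 j2].
  have mono u v : phi u < phi v -> u < v.
    by move=> h; rewrite ltNge; apply/negP => /lephi; rewrite leNgt h.
  by apply: (sep i j (psi t)); apply: mono; rewrite psiK.
- rewrite (_ : \sum_(l < n) _ = \sum_(i < n) (y i - x i) +
      \sum_(i < n) (V (y i) - V (x i))); last first.
    by rewrite -big_split /=; apply: eq_bigr => i _; rewrite /La !phiK; ring.
  pose s := [seq (x i, y i) | i <- enum 'I_n].
  have sumE (F : R * R -> R) : \sum_(p <- s) F p = \sum_(i < n) F (x i, y i).
    by rewrite /s big_map big_enum.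
  have := Hd s; rewrite /family_length !sumE /= => /(_ _ s1) HV.
  suff /HV : interval_family A B s by lra.
  apply/andP; split.
    apply/allP => _ /mapP[i _ ->] /=; have [h1 [h2 h3]] := xy i.
    by rewrite (le_trans Aa h1) h2 (le_trans h3 bB).
  rewrite pairwise_map.
  apply: (@sub_in_pairwise _ predT (fun i j => i != j)); last first.
  + by rewrite -uniq_pairwise enum_uniq.
  + by apply/allP.
  move=> i j _ _ ij; rewrite /interior_disjoint /= leNgt; apply/negP.
  rewrite gt_max !lt_min => /andP[/andP[i1 i2] /andP[i3 i4]].
  pose t := (Num.max (x i) (x j) + Num.min (y i) (y j)) / 2.
  have : Num.max (x i) (x j) < Num.min (y i) (y j) by rewrite gt_max !lt_min i1 i2 i3.
  have : x i <= Num.max (x i) (x j) by rewrite le_max lexx.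
  have : x j <= Num.max (x i) (x j) by rewrite le_max lexx orbT.
  have : Num.min (y i) (y j) <= y i by rewrite ge_min lexx.
  have : Num.min (y i) (y j) <= y j by rewrite ge_min lexx orbT.
  rewrite /t; set q1 := Num.max _ _; set q2 := Num.min _ _ => k1 k2 k3 k4 k5.
  by move/eqP: ij; apply; apply: (sep i j ((q1 + q2) / 2));
    clear -k1 k2 k3 k4 k5; lra.
Qed.

End IncreasingWelding.

(** * Reduction to the upper half-plane *)

Section Reduction.
Variable R : realType.
Local Open Scope classical_set_scope.
Local Open Scope complex_scope.
Implicit Types (G H : R[i] -> R[i]) (z w : R[i]) (f phi : R -> R).
Implicit Types (a b x y e d t : R) (s : side).
Local Notation normc := ComplexField.Normc.normc.

Definition reflect_side s z : R[i] := if s is Above then z else conjc z.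

Lemma reflect_sideK s : involutive (reflect_side s).
Proof. by case: s => // -[a b] /=; rewrite opprK. Qed.

Lemma reflect_sideB s z w :
  reflect_side s (z - w) = reflect_side s z - reflect_side s w.
Proof.
case: s => //; case: z; case: w => a b c d /=.
by apply/eqP; rewrite eq_complex /=; apply/andP; split; apply/eqP; ring.
Qed.

Lemma reflect_sideD s z w :
  reflect_side s (z + w) = reflect_side s z + reflect_side s w.
Proof.
case: s => //; case: z; case: w => a b c d /=.
by apply/eqP; rewrite eq_complex /=; apply/andP; split; apply/eqP; ring.
Qed.

Lemma reflect_sideM s z w :
  reflect_side s (z * w) = reflect_side s z * reflect_side s w.
Proof.
case: s => //; case: z; case: w => a b c d /=.
by apply/eqP; rewrite eq_complex /=; apply/andP; split; apply/eqP; ring.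
Qed.

Lemma reflect_side_real s x : reflect_side s x%:C = x%:C.
Proof. by case: s => //=; rewrite oppr0. Qed.

Lemma normc_reflect_side s z : normc (reflect_side s z) = normc z.
Proof. by case: s => //; case: z => a b /=; rewrite sqrrN. Qed.

Lemma half_plane_reflect_side s z :
  half_plane R s (reflect_side s z) <-> 0 < complex.Im z.
Proof. by case: s; case: z => a b //=; rewrite oppr_lt0. Qed.

Lemma derivable_reflect_side s G z : derivable G (reflect_side s z) 1 ->
  derivable (fun w => reflect_side s (G (reflect_side s w))) z 1.
Proof.
move=> /derivable_epsP[d dG]; apply/derivable_epsP.
exists (reflect_side s d) => e e0; have [r r0 Hr] := dG e e0; exists r => // w wr.
have := Hr (reflect_side s w).
rewrite -reflect_sideB normc_reflect_side => /(_ wr).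
rewrite -(normc_reflect_side s) reflect_sideB reflect_sideD reflect_sideM.
by rewrite reflect_sideK.
Qed.

Lemma closure_epsP (A : set R[i]) z :
  closure A z <-> forall e, 0 < e -> exists2 w, A w & normc (w - z) < e.
Proof.
split=> [cA e e0|H B].
  have : nbhs z (ball z e%:C) by apply: nbhsx_ballx; rewrite ltcR.
  move=> /cA[w [Aw]]; rewrite /ball/= normc_norm ltcR normcB_sym => wz.
  by exists w.
move=> /nbhs_ballP[r /= r0 Hr].
move: r0 Hr; case: r => r ri; rewrite ltcE/= => /andP[/eqP -> r0] Hr.
have [w Aw wz] := H r r0; exists w; split => //; apply: Hr.
by rewrite /ball/= normc_norm complexr0 ltcR normcB_sym.
Qed.

Lemma closure_half_plane s z :
  closure (half_plane R s) (reflect_side s z) <-> 0 <= complex.Im z.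
Proof.
rewrite closure_epsP; split=> [H|z0 e e0].
  rewrite leNgt; apply/negP => z0.
  have [w hw] := H (- complex.Im z) ltac:(by rewrite oppr_gt0).
  rewrite -(reflect_sideK s w) in hw *; move: hw => /half_plane_reflect_side.
  set v := reflect_side s w => v0; rewrite -reflect_sideB normc_reflect_side => lt.
  have := le_lt_trans (Im_le_normc _) lt; rewrite ImD ImN.
  by move/(le_lt_trans (ler_norm _)); lra.
exists (reflect_side s (z + (0 +i* (e / 2)))).
  by apply/half_plane_reflect_side; rewrite ImD /=; lra.
rewrite -reflect_sideB normc_reflect_side addrC addKr.
apply: le_lt_trans (normc_le_ReIm _) _.
by rewrite /= normr0 add0r gtr0_norm ?divr_gt0//; lra.
Qed.

Lemma locally_abs_continuous_eps f : locally_abs_continuous f ->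
  forall x e, 0 < e -> exists2 d, 0 < d &
    forall x', `|x' - x| < d -> `|f x' - f x| < e.
Proof.
move=> flac x e e0.
have [d d0 Hd] := abs_continuous_on_seq (flac (x - 1) (x + 1) ltac:(lra)) e0.
exists (Num.min d 1) => [|x']; first by rewrite lt_min d0 ltr01.
rewrite lt_min => /andP[h1 h2].
have single u v : x - 1 <= u -> u <= v -> v <= x + 1 -> v - u < d ->
    `|f v - f u| < e.
  move=> xu uv vx vud; have := Hd [:: (u, v)].
  rewrite /interval_family /family_length /family_variation !big_seq1 /=.
  by rewrite xu uv vx; apply.
move: h1 h2; have [xx'|/ltW x'x] := leP x x'.
  rewrite ger0_norm ?subr_ge0// => h1 h2; apply: single => //; lra.
rewrite distrC ger0_norm ?subr_ge0// => h1 h2; rewrite distrC.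
by apply: single => //; lra.
Qed.

(** By continuity of [f], a point on the wrong side of the graph has a whole
    neighbourhood on the wrong side. *)
Lemma graph_domain_boundary s f z : locally_abs_continuous f ->
  closure (graph_domain s f) z -> ~ graph_domain s f z ->
  complex.Im z = f (complex.Re z).
Proof.
move=> flac /closure_epsP clz notz.
pose gap := `|complex.Im z - f (complex.Re z)|.
have [/eqP|gap0] := eqVneq gap 0.
  by rewrite normr_eq0 subr_eq0 => /eqP.
have {}gap0 : 0 < gap by rewrite lt_neqAle eq_sym gap0 normr_ge0.
have gap2 : 0 < gap / 2 by rewrite divr_gt0.
have [d d0 Hd] := locally_abs_continuous_eps flac (complex.Re z) gap2.
have [|w ws] := clz (Num.min d (gap / 2)); first by rewrite lt_min d0.
rewrite lt_min => /andP[w1 w2].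
have := Hd (complex.Re w).
have -> : complex.Re w - complex.Re z = complex.Re (w - z) by rewrite ReD ReN.
move=> /(_ (le_lt_trans (Re_le_normc _) w1)).
have := le_lt_trans (Im_le_normc _) w2; rewrite ImD ImN.
rewrite !ltr_norml => /andP[k1 k2] /andP[k3 k4]; exfalso.
case: s notz ws {clz} => /= /negP; rewrite -leNgt => notz ws.
  have gE : gap = f (complex.Re z) - complex.Im z.
    by rewrite /gap ler0_norm ?opprB// subr_le0.
  by clear -gE k1 k2 k3 k4 ws; lra.
have gE : gap = complex.Im z - f (complex.Re z).
  by rewrite /gap ger0_norm// subr_ge0.
by clear -gE k1 k2 k3 k4 ws; lra.
Qed.

(** [h] is the increment of [H] between [G z] and [G (z + h)], and [H] is Lipschitz
    at [G z]. *)
Lemma inverse_difference_lower_bound G H z r :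
  derivable G z 1 -> derivable H (G z) 1 -> 0 < r ->
  (forall w, normc (w - z) < r -> H (G w) = w) ->
  exists2 c : R, 0 < c & exists2 d0 : R, 0 < d0 & forall h : R, 0 < h -> h < d0 ->
    c <= normc ((G (z + h%:C) - G z) / h%:C).
Proof.
move=> /derivable_epsP[k Gk] /derivable_epsP[l Hl] r0 HG.
have [r1 r10 H1] := Gk 1 ltr01; have [r2 r20 H2] := Hl 1 ltr01.
have k0 : 0 < normc k + 1 by have := normc_ge0 k; lra.
have l0 : 0 < normc l + 1 by have := normc_ge0 l; lra.
exists (normc l + 1)^-1; first by rewrite invr_gt0.
exists (Num.min (Num.min r r1) (r2 / (normc k + 1))).
  by rewrite !lt_min r0 r10 divr_gt0.
move=> h h0; rewrite !lt_min ltr_pdivlMr// => /andP[/andP[hr hr1] hr2].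
have zh : (z + h%:C) - z = h%:C by rewrite addrC addKr.
have nh : normc ((z + h%:C) - z) = h by rewrite zh normc_real gtr0_norm.
have bG : normc (G (z + h%:C) - G z) < r2.
  apply: le_lt_trans hr2.
  have := H1 (z + h%:C); rewrite nh => /(_ hr1).
  rewrite zh mul1r => le1.
  have -> : G (z + h%:C) - G z = (G (z + h%:C) - (G z + k * h%:C)) + k * h%:C by ring.
  apply: le_trans (normc_D _ _) _; rewrite normcM normc_real gtr0_norm//.
  by lra.
have := H2 _ bG; rewrite mul1r HG ?nh// HG ?subrr ?normc0// => le2.
have : h <= (normc l + 1) * normc (G (z + h%:C) - G z).
  rewrite -[leLHS]nh.
  set u := G (z + h%:C) - G z in le2 *.
  have -> : z + h%:C - z = (z + h%:C - (z + l * u)) + l * u by ring.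
  by apply: le_trans (normc_D _ _) _; rewrite normcM; lra.
rewrite normcM normcV normc_real gtr0_norm// ler_pdivlMr//.
by rewrite ler_pdivrMl.
Qed.

Lemma locally_abs_continuous_opp f : locally_abs_continuous f ->
  locally_abs_continuous (fun x => f (- x)).
Proof.
move=> flac a b ab e e0.
have [|d d0 Hd] := flac (- b) (- a) _ e e0; first by rewrite lerN2.
exists d => // n x y xy tri sd.
have := Hd n (fun i => - y i) (fun i => - x i).
rewrite (eq_bigr (fun i => y i - x i)); last by move=> i _; rewrite opprK addrC.
have -> : \sum_(i < n) `|f (- y i) - f (- x i)| =
    \sum_(i < n) `|f (- x i) - f (- y i)|.
  by apply: eq_bigr => i _; rewrite distrC.
apply => //.
  by move=> i; have [h1 [h2 h3]] := xy i; rewrite !lerN2.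
move=> i j _ _ [t [/=]]; rewrite !in_itv/= => i1 j1.
apply: (tri i j I I); exists (- t).
by split; rewrite /= in_itv/= ltrNr (ltrNl t) andbC.
Qed.

End Reduction.

(** * The graph welding *)

Theorem theorem3p7 (R : realType) (f : R -> R)
    (f_lac : locally_abs_continuous f)
    (s : side) (G : R[i] -> R[i])
    (G_conformal : biholomorphic (half_plane R s) (graph_domain s f) G)
    (G_infty : fixes_infinity (half_plane R s) G)
    (phi : R -> R) (phi_welding : graph_welding s f G phi) :
  locally_abs_continuous phi.
Proof.
case: phi_welding => Gbar [[[Gfun Ginj Gsurj] cGbar [H2 cH2 H2K]] GbarE Gphi].
case: G_conformal => [[Gf Gi Gs] holG [H holH HK]].
pose fl := reflect_side (R := R) s.
pose g z := fl (Gbar (fl z)).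
pose normc := @ComplexField.Normc.normc R.
have clos z : 0 <= complex.Im z -> closure (half_plane R s) (fl z).
  by move=> z0; apply/closure_half_plane.
have closR x : closure (half_plane R s) x%:C%C.
  by rewrite -(reflect_side_real s x); apply: clos.
have cf := locally_abs_continuous_eps f_lac.
have Fdist x x' : normc (graph_map f x' - graph_map f x) <= `|x' - x| + `|f x' - f x|.
  exact: normc_le_ReIm.
have H2phi x : H2 (graph_map f x) = (phi x)%:C%C.
  by rewrite -Gphi H2K// inE; exact: closR.
have clF x : closure (graph_domain s f) (graph_map f x).
  by rewrite -Gphi; apply: Gfun; exact: closR.
have phi_inj x x' : phi x = phi x' -> x = x'.
  by move=> e; have := Gphi x; rewrite e Gphi => -[].
have phi_cont : continuous phi.
  move=> x; apply/cvgrPdist_lt => e e0.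
  have /within_continuous_epsP /(_ _ (clF x) e e0)[d d0 Hd] := cH2.
  have d2 : 0 < d / 2 by rewrite divr_gt0.
  have [d1 d10 Hd1] := cf x _ d2.
  apply/nbhs_ballP; exists (Num.min d1 (d / 2)); first by rewrite /= lt_min d10.
  move=> x'; rewrite /ball/= lt_min (distrC x) => /andP[h1 h2].
  have phiB : (phi x')%:C%C - (phi x)%:C%C = (phi x' - phi x)%:C%C by rewrite rmorphB.
  have := Hd _ (clF x'); rewrite !H2phi phiB normc_real distrC; apply.
  by apply: le_lt_trans (Fdist x x') _; have := Hd1 x' h1; lra.
have phi_surj t : exists x, phi x = t.
  (* a boundary value of Gbar lies on the graph: it is not in the domain, which
     is already covered by the injective G *)
  have clG := Gfun _ (closR t).
  have nG : ~ graph_domain s f (Gbar t%:C%C).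
    move=> /Gs[w hw Gw].
    have w0 : 0 < complex.Im (fl w).
      by apply/(half_plane_reflect_side s); rewrite /fl reflect_sideK.
    have wt : w = t%:C%C.
      apply: Ginj; rewrite ?inE; [|exact: closR|by rewrite -Gw GbarE ?inE].
      by rewrite -(reflect_sideK s w); apply: clos; exact: ltW.
    by move: w0; rewrite wt /fl reflect_side_real ltxx.
  have onG := graph_domain_boundary f_lac clG nG.
  exists (complex.Re (Gbar t%:C%C)).
  suff : (phi (complex.Re (Gbar t%:C%C)))%:C%C = t%:C%C by case.
  apply: Ginj; rewrite ?inE; [exact: closR|exact: closR|].
  by rewrite Gphi /graph_map -onG; case: (Gbar _).
have dg w : 0 < complex.Im w -> derivable g w 1.
  move=> w0; apply: derivable_reflect_side.
  have hw : half_plane R s (fl w) by apply/half_plane_reflect_side.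
  have /derivable_epsP[d dG] := holG _ hw.
  apply/derivable_epsP; exists d => e e0; have [r r0 Hr] := dG e e0.
  exists (Num.min r (complex.Im w)); first by rewrite lt_min r0.
  move=> v; rewrite lt_min => /andP[vr vw].
  have hv : half_plane R s v.
    rewrite -(reflect_sideK s v); apply/half_plane_reflect_side.
    have : normc (fl v - w) < complex.Im w.
      by rewrite /normc -(normc_reflect_side s) reflect_sideB reflect_sideK.
    move/(le_lt_trans (Im_le_normc _)); rewrite ImD ImN ltr_norml => /andP[+ _].
    by rewrite /fl; lra.
  by rewrite !GbarE ?inE//; exact: Hr.
have cg : ({within [set w | 0 <= complex.Im w], continuous g})%classic.
  apply/within_continuous_epsP => z z0 e e0.
  have /within_continuous_epsP /(_ _ (clos z z0) e e0)[d d0 Hd] := cGbar.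
  exists d => // w w0 wz; rewrite /g /fl -reflect_sideB normc_reflect_side.
  apply: Hd; first exact: clos.
  by rewrite /fl -reflect_sideB normc_reflect_side.
have lowg y : 0 < y -> exists2 c : R, 0 < c & exists2 d0 : R, 0 < d0 &
    forall h : R, 0 < h -> h < d0 ->
      c <= normc ((g (Complex 0 y + h%:C%C) - g (Complex 0 y)) / h%:C%C).
  move=> y0; set z0 := Complex 0 y.
  have hz : half_plane R s (fl z0) by apply/half_plane_reflect_side.
  have [|c c0 [d0 d00 low]] := @inverse_difference_lower_bound R G H (fl z0) y
      (holG _ hz) (holH _ (Gf _ hz)) y0.
    move=> w wz; apply: HK; rewrite inE.
    rewrite -(reflect_sideK s w); apply/half_plane_reflect_side.
    have : normc (fl w - z0) < y.
      by rewrite /normc -(normc_reflect_side s) reflect_sideB reflect_sideK.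
    move/(le_lt_trans (Im_le_normc _)); rewrite ImD ImN ltr_norml => /andP[+ _].
    by rewrite /fl /=; lra.
  exists c => //; exists d0 => // h h0 hd.
  have := low h h0 hd.
  have hz' : half_plane R s (fl (z0 + h%:C%C)).
    by apply/half_plane_reflect_side; rewrite ImD /= addr0.
  rewrite /normc !normcM /g /fl -reflect_sideB normc_reflect_side.
  by rewrite !GbarE ?inE// reflect_sideD reflect_side_real.
have gphi (p : R -> R) (k : R -> R) (kE : forall x, p x = phi (k x)) x y :
    normc (g (p y)%:C%C - g (p x)%:C%C) <= `|k y - k x| + `|f (k y) - f (k x)|.
  rewrite !kE /g /fl !reflect_side_real -reflect_sideB /normc normc_reflect_side.
  by rewrite !Gphi; exact: Fdist.
have [mono|mono] : {homo phi : x y / x < y} \/ {homo phi : x y /~ x < y}.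
  have [||h|h] := @itv_continuous_inj_mono R phi `]-oo, +oo[%R.
  - by apply: continuous_subspaceT => x; exact: phi_cont.
  - by move=> x y _ _; exact: phi_inj.
  - by left=> x y; apply: h; rewrite in_itv.
  - by right=> x y; apply: h; rewrite in_itv.
- apply: (@increasing_welding_ac R g f phi) => //.
  exact: (gphi phi id).
- have -> : phi = (fun x => phi (- - x)) by apply/funext => x; rewrite opprK.
  apply: (@locally_abs_continuous_opp R (fun x => phi (- x))).
  apply: (@increasing_welding_ac R g (fun x => f (- x)) (fun x => phi (- x))) => //.
  + exact: locally_abs_continuous_opp.
  + move=> x y; have := gphi (fun x => phi (- x)) -%R (fun=> erefl) x y.
    by rewrite -opprD normrN.
  + by move=> x y xy; apply: mono; rewrite ltrN2.
  + by move=> t; have [x <-] := phi_surj t; exists (- x); rewrite opprK.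
Qed.
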